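(* Let $G$ be a finite group, $F$ a field, $V$ a finite dimensional representation of $G$ over $F$, and $n=\dim(V)$. Assume $d_1,\ldots,d_n$ are the degrees of a homogeneous system of parameters of $F[V]^G$. Then (a) $\operatorname{topdeg}(F[V]_G)\le \sum_{i=1}^n (d_i-1)$, (b) $\dim(F[V]_G)\le \prod_{i=1}^n d_i$. In particular, $\operatorname{topdeg}(F[V]_G)\le \dim(V)(|G|-1)$ and $\dim(F[V]_G)\le |G|^n$. If the system of parameters generates $F[V]^G$ (as an $F$-algebra), then equality holds in (a) and (b).
   Context: $F[V]$ denotes the symmetric algebra of $V^*$ (a polynomial ring in $n=\dim V$ variables with the standard grading), with the induced $G$-action $g(f)=f\circ g^{-1}$, and $F[V]^G$ is the ring of invariants. The Hilbert ideal $I_H$ is the ideal of $F[V]$ generated by all invariants of positive degree, and the coinvariant ring is the graded finite dimensional algebra $F[V]_G=F[V]/I_H$. $\dim(F[V]_G)$ is its dimension as an $F$-vector space, and $\operatorname{topdeg}(F[V]_G)$ is the largest degree in which $F[V]_G$ is nonzero. *)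

(* Defs.v *)
From HB Require Import structures.
From mathcomp Require Import all_boot all_order all_algebra all_fingroup.
From mathcomp Require Import mxrepresentation boolp.
From mathcomp Require Import mpoly.

Set Implicit Arguments.
Unset Strict Implicit.
Unset Printing Implicit Defensive.

Import GRing.Theory.
Local Open Scope ring_scope.
Local Open Scope quotient_scope.

Section Invariants.

Variables (F : fieldType) (gT : finGroupType) (G : {group gT}) (n : nat).
Variable rG : mx_representation F G n.
Implicit Types (f h p : {mpoly F[n]}) (d : nat).

(* V is 'cV[F]_n with the left action g . v = rG g *m v, and 'X_i is the i-th
   coordinate function on V. The right-hand tuple below lists the coordinates
   of g^-1 . v, so this is the action f |-> f \o g^-1 (see mpoly_actE). *)
Definition mpoly_act (g : gT) f : {mpoly F[n]} :=
  f \mPo [tuple \sum_(j < n) rG g^-1%g i j *: 'X_j | i < n].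

Lemma mpoly_actE g f (v : 'cV[F]_n) :
  (mpoly_act g f).@[fun i => v i 0] = f.@[fun i => (rG g^-1%g *m v) i 0].
Proof.
rewrite /mpoly_act comp_mpoly_meval; apply: meval_eq => i.
rewrite tnth_map tnth_ord_tuple mxE raddf_sum; apply: eq_bigr => j _ /=.
by rewrite mevalZ mevalXU.
Qed.

Definition invariant f : Prop := {in G, forall g, mpoly_act g f = f}.

(* Invariants of positive degree are homogeneous: allowing arbitrary ones, such
   as 1 + f, would make the ideal below the unit ideal. *)
Definition pos_invariant f : Prop :=
  invariant f /\ exists2 d, (0 < d)%N & f \is d.-homog.

Definition in_hilbert_ideal f : Prop :=
  exists k (a u : 'I_k -> {mpoly F[n]}),
    (forall i, pos_invariant (u i)) /\ f = \sum_(i < k) a i * u i.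

Definition hilbert_ideal : pred {mpoly F[n]} := fun f => `[< in_hilbert_ideal f >].

Lemma hilbert_ideal_idealr : idealr_closed hilbert_ideal.
Proof.
split.
- apply/asboolP; exists 0, (fun _ => 0), (fun _ => 0).
  by split=> [[]|] //; rewrite big_ord0.
- apply/negP => /asboolP [k [a [u [hu e]]]].
  move/(congr1 (meval (fun _ => 0))): e; rewrite meval1 raddf_sum big1.
    by move/eqP; rewrite oner_eq0.
  move=> i _; rewrite /= mevalM; have [_ [d d_gt0 /dhomogP hd]] := hu i.
  rewrite [X in _ * X](_ : _ = 0) ?mulr0 // mevalE big_seq big1 // => m /hd dm.
  case: (pickP (fun j => m j != 0%N)) => [j mj | m0].
    by rewrite (bigD1 j) //= expr0n (negbTE mj) mul0r mulr0.
  have em : mdeg m = d by [].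
  move: d_gt0; rewrite -em mdegE big1 // => j _.
  by apply/eqP; move/negbT: (m0 j); rewrite negbK.
- move=> c f h /asboolP [k [a [u [hu ->]]]] /asboolP [l [b [w [hw ->]]]].
  apply/asboolP; exists (k + l)%N.
  exists (fun i => match split i with inl j => c * a j | inr j => b j end).
  exists (fun i => match split i with inl j => u j | inr j => w j end).
  split=> [i|]; first by case: split.
  rewrite big_split_ord /= mulr_sumr; congr (_ + _); apply: eq_bigr => i _.
    by rewrite (unsplitK (inl i)) mulrA.
  by rewrite (unsplitK (inr i)).
Qed.

HB.instance Definition _ :=
  isIdealr.Build {mpoly F[n]} hilbert_ideal hilbert_ideal_idealr.

Definition coinvariants := {ideal_quot (hilbert_ideal : idealr {mpoly F[n]})}.

HB.instance Definition _ := GRing.ComNzRing.on coinvariants.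

Definition coinv_pi f : coinvariants := \pi_coinvariants f.

Lemma coinv_pi_eq0 f : (coinv_pi f = 0) <-> in_hilbert_ideal f.
Proof.
have -> : (0 : coinvariants) = \pi_coinvariants 0 by rewrite raddf0.
split=> [/eqP|h]; last apply/eqP.
  by rewrite /coinv_pi -Quotient.idealrBE subr0 => /asboolP.
by rewrite /coinv_pi -Quotient.idealrBE subr0; apply/asboolP.
Qed.

Definition coinv_scale (c : F) (x : coinvariants) : coinvariants :=
  coinv_pi c%:MP * x.

Fact coinv_scaleA a b x : coinv_scale a (coinv_scale b x) = coinv_scale (a * b) x.
Proof. by rewrite /coinv_scale /coinv_pi mpolyCM rmorphM mulrA. Qed.

Fact coinv_scale1 : left_id 1 coinv_scale.
Proof. by move=> x; rewrite /coinv_scale /coinv_pi rmorph1 mul1r. Qed.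

Fact coinv_scaleDr : right_distributive coinv_scale +%R.
Proof. by move=> c x y; rewrite /coinv_scale mulrDr. Qed.

Fact coinv_scaleDl x : {morph coinv_scale^~ x : a b / a + b}.
Proof. by move=> a b; rewrite /coinv_scale /coinv_pi mpolyCD rmorphD mulrDl. Qed.

HB.instance Definition _ := GRing.Zmodule_isLmodule.Build F coinvariants
  coinv_scaleA coinv_scale1 coinv_scaleDr coinv_scaleDl.

Definition coinv_deg d (x : coinvariants) : Prop :=
  exists2 f, f \is d.-homog & coinv_pi f = x.

Definition is_topdeg (t : nat) : Prop :=
  (exists2 x, coinv_deg t x & x <> 0) /\
  forall d x, coinv_deg d x -> x <> 0 -> (d <= t)%N.

(* A linear bijection onto 'rV[F]_m; this includes finite dimensionality. *)
Definition coinv_has_dim (m : nat) : Prop :=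
  inhabited (Vector.axiom m coinvariants).

Definition alg_independent (fs : n.-tuple {mpoly F[n]}) : Prop :=
  forall p, p \mPo fs = 0 -> p = 0.

(* The elements of the subalgebra F[fs] are the c \mPo fs, so this says that
   F[V]^G is finitely generated as an F[fs]-module. *)
Definition module_finite (fs : n.-tuple {mpoly F[n]}) : Prop :=
  exists k (s : 'I_k -> {mpoly F[n]}),
    (forall i, invariant (s i)) /\
    forall f, invariant f ->
      exists c : 'I_k -> {mpoly F[n]}, f = \sum_(i < k) (c i \mPo fs) * s i.

Definition hsop (fs : n.-tuple {mpoly F[n]}) (d : 'I_n -> nat) : Prop :=
  [/\ forall i, [/\ invariant (tnth fs i), (0 < d i)%N
                  & tnth fs i \is (d i).-homog],
      alg_independent fs
    & module_finite fs].

Definition generates_invariants (fs : n.-tuple {mpoly F[n]}) : Prop :=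
  forall f, invariant f -> exists p : {mpoly F[n]}, f = p \mPo fs.

End Invariants.

(* Main.v *)
Require Import Defs.
From HB Require Import structures.
From mathcomp Require Import all_boot all_order all_algebra all_fingroup.
From mathcomp Require Import mxrepresentation boolp.
From mathcomp Require Import mpoly.
From mathcomp Require Import generic_quotient.
From mathcomp Require Import zify ring lra.

(** Let S = F[V] and let H be the Hilbert ideal.  A homogeneous system of
    parameters f_1, ..., f_n of the invariants generates an ideal I of S
    contained in H, so the coinvariant ring S/H is a quotient of S/I, and it is
    S/I itself when the f_i generate the invariants, because then every
    invariant of positive degree is a polynomial without constant term in the
    f_i.  Everything therefore follows from the Hilbert series of S/I: it is
    the product of the polynomials 1 + t + ... + t^(d_i - 1)
    ([hilb_parameters]), of degree the sum of the d_i - 1 and of value the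
    product of the d_i at t = 1.

    That S/I is finite dimensional is seen as follows.  Since the invariants
    are a finite module over F[f_1, ..., f_n], all invariants of large degree
    lie in I.  Each coordinate x_i is a root of the monic polynomial
    prod_g (T - g x_i), whose lower coefficients are invariants of positive
    degree and hence nilpotent modulo I; so x_i is nilpotent modulo I.  The same
    polynomial shows that x_i^|G| is in H.  This makes S/H finite dimensional,
    and the Hilbert series of S/(x_1^|G|, ..., x_n^|G|), which is another
    instance of the formula above, yields the bounds in terms of |G|.

    The formula for the Hilbert series says that n forms generating an ideal of
    finite codimension in n variables form a regular sequence
    ([cofinite_regular]).  This is proved by counting dimensions.  Dividing S/J
    by a form y of degree d multiplies the Hilbert series by 1 - t^d, up to a
    nonnegative error that vanishes exactly when y is a nonzerodivisor
    ([hilb_adjoin]).  As 1/(1 - t^d) has nonnegative coefficients, a sequence of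
    forms whose quotient is not larger than the formula for a regular sequence
    predicts is regular ([regular_hilb]).

    To get that upper bound, argue by induction on the number of variables.  Let
    y be one of the parameters, of degree d, and J the ideal of the others.
    Finite codimension makes multiplication by y an isomorphism of S/J from
    degree k to degree k + d for all large k.  Over the field F(t) the linear
    form L = x_0 + t x_1 + t^2 x_2 + ... is then injective on S/J in large
    degrees: an element killed by L is killed by a power of each x_i
    ([annihilates_coef], a form of McCoy's theorem), hence by a power of y.  So
    the Hilbert function of S/J is nondecreasing and periodic in large degrees,
    hence constant, and L too is an isomorphism in large degrees.  Thus
    S/(J, L) is finite dimensional; eliminating x_0 by means of L leaves n - 1
    parameters in n - 1 variables, whose Hilbert series is known by induction.
    The count now shows that J and L form a regular sequence.  A power of L
    moves any element of S/J into the degrees where y is injective, so y is a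
    nonzerodivisor on S/J, and regularity descends from F(t) to F. *)

Set Implicit Arguments.
Unset Strict Implicit.
Unset Printing Implicit Defensive.

Import Order.TTheory GRing.Theory Num.Theory.
Local Open Scope ring_scope.

(** * Subspaces cut out by a predicate, power series and forms *)

Definition subspace_pred (F : fieldType) (V : lmodType F) (P : V -> Prop) :=
  [/\ P 0, forall u v, P u -> P v -> P (u + v) & forall c u, P u -> P (c *: u)].

Section Comprehension.
Variables (F : fieldType) (V : vectType F).
Implicit Type P : V -> Prop.

(** Among the subspaces contained in [P], one of maximal dimension is all of
    [P]: otherwise it could be enlarged by a line. *)
Lemma vspace_of_ex P : subspace_pred P -> exists U : {vspace V}, forall u, u \in U <-> P u.
Proof.
move=> [P0 PD PZ]; apply: contrapT => noU.
have grow d : exists2 U : {vspace V}, (forall u, u \in U -> P u) & \dim U = d.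
  elim: d => [|d [U UP dU]].
    by exists 0%VS; rewrite ?dimv0 // => u; rewrite memv0 => /eqP->.
  have [u [Pu uU]] : exists u, P u /\ u \notin U.
    apply: contrapT => H; apply: noU; exists U => u; split=> [/UP//|Pu].
    by apply: contrapT => uU; apply: H; exists u; split=> //; apply/negP.
  exists (U + <[u]>)%VS.
    by move=> _ /memv_addP[v vU [_ /vlineP[c ->] ->]]; apply: PD; [exact: UP|exact: PZ].
  have u0 : u != 0 by apply: contraNneq uU => ->; rewrite mem0v.
  rewrite dimv_disjoint_sum ?dU ?dim_vline ?u0 ?addn1 //.
  apply/eqP; rewrite -subv0; apply/subvP => v; rewrite memv_cap memv0.
  case/andP=> vU /vlineP[c vc]; rewrite vc in vU *.
  have [->|c0] := eqVneq c 0; first by rewrite scale0r.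
by rewrite rpredZeq (negbTE c0) (negbTE uU) in vU.
have [U _ dU] := grow (\dim {:V}).+1.
by have := dimvS (subvf U); rewrite dU ltnn.
Qed.

Definition vspace_of P : {vspace V} :=
  if pselect (exists U : {vspace V}, forall u, u \in U <-> P u) is left h
  then projT1 (cid h) else 0%VS.

Lemma vspace_ofP P u : subspace_pred P -> u \in vspace_of P <-> P u.
Proof.
move=> sP; rewrite /vspace_of; case: pselect => [h|]; last by have := vspace_of_ex sP.
by case: (cid h).
Qed.

End Comprehension.

Section SeriesAction.
Implicit Types (p q : {poly int}) (h : nat -> int) (d k : nat).

(** The coefficients of the product of [p] with the formal power series whose
    coefficients are [h].  Hilbert functions are multiplied by the factors
    1 - t^d in this way. *)
Definition convol p h k : int := \sum_(i < k.+1) p`_i * h (k - i)%N.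

Lemma convol_coef p h k K : (k < K)%N -> convol p h k = (p * \poly_(i < K) h i)`_k.
Proof.
move=> kK; rewrite coefM; apply: eq_bigr => i _.
by rewrite coef_poly (leq_ltn_trans (leq_subr _ _) kK).
Qed.

Lemma convolM p q h k : convol (p * q) h k = convol p (convol q h) k.
Proof.
rewrite (convol_coef _ _ (ltnSn k)) -mulrA coefM; apply: eq_bigr => i _.
by rewrite (@convol_coef _ _ _ k.+1) // ltnS leq_subr.
Qed.

Lemma convol_ext p h h' k : (forall i, (i <= k)%N -> h i = h' i) -> convol p h k = convol p h' k.
Proof. by move=> e; apply: eq_bigr => i _; rewrite e ?leq_subr. Qed.

Lemma convol1 h k : convol 1 h k = h k.
Proof.
rewrite /convol big_ord_recl coef1 mul1r subn0 big1 ?addr0 // => i _.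
by rewrite coef1 mul0r.
Qed.

Lemma convol_delta p k : convol p (fun i => (i == 0)%:R) k = p`_k.
Proof.
rewrite /convol big_ord_recr /= subnn mulr1 big1 ?add0r // => i _.
by rewrite subn_eq0 leqNgt ltn_ord mulr0.
Qed.

Lemma convol_1subXn d h k :
  convol (1 - 'X^d) h k = h k - (if (d <= k)%N then h (k - d)%N else 0).
Proof.
rewrite (convol_coef _ _ (ltnSn k)) mulrBl mul1r coefB coefXnM !coef_poly ltnSn.
by rewrite ltnS leq_subr; case: ltnP.
Qed.

(** Multiplication by 1/(1 - t^d) preserves coefficientwise inequalities, its
    coefficients being nonnegative. *)
Lemma convol_1subXn_le d h h' : (0 < d)%N ->
  (forall k, convol (1 - 'X^d) h k <= convol (1 - 'X^d) h' k) -> forall k, h k <= h' k.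
Proof.
move=> d0 H; elim/ltn_ind => k IH; have := H k; rewrite !convol_1subXn.
case: ifP => dk; last by rewrite !subr0.
have := IH (k - d)%N; rewrite ltn_subrL d0 (leq_trans d0 dk) => /(_ isT).
lra.
Qed.

End SeriesAction.

Section Forms.
Variables (F : fieldType) (n : nat).
Local Notation S := {mpoly F[n]}.
Implicit Types (p q : S) (k d : nat).

(** A copy of the space of homogeneous polynomials that is finite dimensional
    for every number of variables, zero included: the base case of the induction
    on variables needs it. *)
Definition hform k := dhomog n F k.
HB.instance Definition _ k := GRing.SubLmodule.on (hform k).

Definition monom_deg k := {m : 'X_{1..n < k.+1} | mdeg m == k}.

Lemma monom_deg_ex k (m : 'X_{1..n}) : mdeg m = k -> exists i : monom_deg k, val (val i) = m.
Proof.
move=> mk; have lt : (mdeg m < k.+1)%N by rewrite mk.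
have e : mdeg (BMultinom lt) == k by apply/eqP.
by exists (Sub (BMultinom lt) e).
Qed.

Fact form_vecaxiom k : Vector.axiom #|{: monom_deg k}| (hform k).
Proof.
pose g (r : 'rV[F]_#|{: monom_deg k}|) : S := \sum_i r 0 i *: 'X_[val (val (enum_val i))].
have gh r : g r \is k.-homog.
  apply: rpred_sum => i _; apply: rpredZ; rewrite dhomogX; exact: (valP (enum_val i)).
have gE r i : (g r)@_(val (val (enum_val i))) = r 0 i.
  rewrite /g raddf_sum (bigD1 i) //= mcoeffZ mcoeffX eqxx mulr1 big1 ?addr0 // => j ji.
  rewrite mcoeffZ mcoeffX (inj_eq val_inj) (inj_eq val_inj) (inj_eq enum_val_inj).
  by rewrite (negbTE ji) mulr0.
exists (fun u : hform k => \row_i (val u)@_(val (val (enum_val i)))).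
  by move=> c u v; apply/rowP => i; rewrite !mxE /= mcoeffD mcoeffZ.
exists (fun r => DHomog (gh r)) => [u|r]; last by apply/rowP => i; rewrite mxE gE.
apply/val_inj/mpolyP => m /=; have [mk|mk] := eqVneq (mdeg m) k.
  by have [i <-] := monom_deg_ex mk; rewrite -(enum_rankK i) gE mxE.
by rewrite (dhomog_nemf_coeff (gh _) mk) (dhomog_nemf_coeff (dhomog_is_dhomog u) mk).
Qed.

HB.instance Definition _ k := Lmodule_hasFinDim.Build F (hform k) (form_vecaxiom k).

End Forms.

(** * Homogeneous ideals and their Hilbert functions *)

(** Prop-valued, because membership in an ideal given by generators or as a
    radical comes without a decision procedure; the unit ideal is an instance. *)
Definition ideal_pred (R : comNzRingType) (I : R -> Prop) :=
  [/\ I 0, forall p q, I p -> I q -> I (p + q) & forall p q, I q -> I (p * q)].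

Section IdealPred.
Variables (R : comNzRingType) (I : R -> Prop).
Hypothesis idI : ideal_pred I.

Lemma ideal_predN p : I p -> I (- p).
Proof. by case: idI => _ _ IM /(IM (-1)); rewrite mulN1r. Qed.

Lemma ideal_predB p q : I p -> I q -> I (p - q).
Proof. by move=> Ip /ideal_predN; case: idI => _ ID _; apply: ID. Qed.

Lemma ideal_predMr p q : I p -> I (p * q).
Proof. by rewrite mulrC; case: idI => _ _; apply. Qed.

Lemma ideal_pred_sum (J : Type) (r : seq J) (P : pred J) (E : J -> R) :
  (forall j, P j -> I (E j)) -> I (\sum_(j <- r | P j) E j).
Proof. by case: idI => I0 ID _ H; elim/big_ind: _. Qed.

Lemma ideal_pred_sum_seq (J : eqType) (r : seq J) (E : J -> R) :
  (forall j, j \in r -> I (E j)) -> I (\sum_(j <- r) E j).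
Proof. by move=> H; rewrite big_seq_cond; apply: ideal_pred_sum => j /andP[/H]. Qed.

End IdealPred.

Section GradedIdeals.
Variables (F : fieldType) (n : nat).
Local Notation S := {mpoly F[n]}.
Implicit Types (p q y : S) (k d : nat) (I : S -> Prop).

Definition graded_ideal I :=
  ideal_pred I /\ forall k p, I p -> I (pihomog mdeg k p).

Definition adjoin I y p := exists a b, I a /\ p = a + b * y.
Definition colon I y p := I (y * p).

Lemma pihomog_sum k p : pihomog mdeg k p = \sum_(j < msize p | j == k :> nat) pihomog mdeg j p.
Proof.
rewrite {1}(pihomog_partitionE (leqnn (msize p))) linear_sum /= [RHS]big_mkcond /=.
apply: eq_bigr => j _; case: eqP => [<-|/eqP jk]; first by rewrite pihomog_id.
by rewrite (pihomog_ne0 jk) // pihomogP.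
Qed.

Lemma pihomogM k d p y : y \is d.-homog ->
  pihomog mdeg (d + k) (p * y) = pihomog mdeg k p * y.
Proof.
move=> hy; rewrite {1}(pihomog_partitionE (leqnn (msize p))) mulr_suml linear_sum /=.
rewrite [in RHS]pihomog_sum mulr_suml [RHS]big_mkcond /=; apply: eq_bigr => j _.
have hj : pihomog mdeg j p * y \is (j + d).-homog by rewrite dhomogM // pihomogP.
case: eqP => [jk|/eqP jk]; first by rewrite pihomog_dE // -jk addnC.
by rewrite (pihomog_ne0 _ hj) // addnC eqn_add2l.
Qed.

Lemma pihomogM_lt k d p y : y \is d.-homog -> (k < d)%N -> pihomog mdeg k (p * y) = 0.
Proof.
move=> hy kd; rewrite {1}(pihomog_partitionE (leqnn (msize p))) mulr_suml linear_sum /=.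
apply: big1 => j _.
have hj : pihomog mdeg j p * y \is (j + d).-homog by rewrite dhomogM // pihomogP.
by rewrite (pihomog_ne0 _ hj) //; apply/eqP; lia.
Qed.

Lemma adjoin_sub I y p : I p -> adjoin I y p.
Proof. by move=> Ip; exists p, 0; rewrite mul0r addr0. Qed.

Lemma adjoin_mem I y : ideal_pred I -> adjoin I y y.
Proof. by case=> I0 _ _; exists 0, 1; rewrite mul1r add0r. Qed.

Lemma adjoin_ideal I y : ideal_pred I -> ideal_pred (adjoin I y).
Proof.
move=> [I0 ID IM]; split.
- by exists 0, 0; rewrite mul0r addr0.
- move=> _ _ [a [b [Ia ->]]] [a' [b' [Ia' ->]]]; exists (a + a'), (b + b').
  by split; [exact: ID|rewrite mulrDl addrACA].
- move=> c _ [a [b [Ia ->]]]; exists (c * a), (c * b).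
  by split; [exact: IM|rewrite mulrDr mulrA].
Qed.

Lemma adjoin_graded I y d : graded_ideal I -> y \is d.-homog -> graded_ideal (adjoin I y).
Proof.
move=> [iI gI] hy; split; first exact: adjoin_ideal.
move=> k _ [a [b [Ia ->]]]; rewrite linearD /=.
case: (leqP d k) => [dk|kd]; last first.
  by rewrite (pihomogM_lt _ hy kd) addr0; apply: adjoin_sub => //; apply: gI.
exists (pihomog mdeg k a), (pihomog mdeg (k - d) b); split; first exact: gI.
by rewrite -{2}(subnKC dk) (pihomogM _ _ hy).
Qed.

Lemma subspace_homog I k : ideal_pred I -> subspace_pred (fun u : hform F n k => I (val u)).
Proof.
move=> [I0 ID IM]; split=> [//|u v|c u Iu]; first exact: ID.
by rewrite /= -mul_mpolyC; apply: IM.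
Qed.

Definition ideal_part I k : {vspace hform F n k} := vspace_of (fun u : hform F n k => I (val u)).
Definition hilb I k : nat := (\dim (fullv : {vspace hform F n k}) - \dim (ideal_part I k))%N.

Lemma mem_ideal_part I k (u : hform F n k) : ideal_pred I -> u \in ideal_part I k <-> I (val u).
Proof. by move=> iI; apply: vspace_ofP; apply: subspace_homog. Qed.

Lemma ideal_part_sub I J k : ideal_pred I -> ideal_pred J ->
  (forall p, p \is k.-homog -> I p -> J p) -> (ideal_part I k <= ideal_part J k)%VS.
Proof.
move=> iI iJ H; apply/subvP => u /(mem_ideal_part _ iI) Iu; apply/(mem_ideal_part _ iJ).
by apply: H => //; apply: dhomog_is_dhomog.
Qed.

Lemma colon_ideal I y : ideal_pred I -> ideal_pred (colon I y).
Proof.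
move=> [I0 ID IM]; rewrite /colon; split=> [|p q Ip Iq|p q Iq]; first by rewrite mulr0.
  by rewrite mulrDr; apply: ID.
by rewrite mulrCA; apply: IM.
Qed.

Lemma hilb_eq0 I k : ideal_pred I ->
  hilb I k = 0%N <-> (forall p, p \is k.-homog -> I p).
Proof.
move=> iI; split=> [/eqP|H].
  rewrite subn_eq0 => le p hp; have e : ideal_part I k = fullv.
    by apply/eqP; rewrite eqEdim subvf.
  by apply/(mem_ideal_part (DHomog hp) iI); rewrite e memvf.
apply/eqP; rewrite subn_eq0 dimvS //; apply/subvP => u _.
by apply/(mem_ideal_part _ iI)/H/dhomog_is_dhomog.
Qed.

Lemma hilb_le I J k : ideal_pred I -> ideal_pred J ->
  (forall p, p \is k.-homog -> I p -> J p) -> (hilb J k <= hilb I k)%N.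
Proof. by move=> iI iJ H; rewrite leq_sub2l // dimvS // ideal_part_sub. Qed.

Section Mul.
Variables (y : S) (d k : nat) (hy : y \is d.-homog).

Definition mulform (u : hform F n k) : hform F n (d + k) :=
  DHomog (dhomogM hy (dhomog_is_dhomog u)).

Fact mulform_linear : linear mulform.
Proof. by move=> c u v; apply: val_inj; rewrite /= mulrDr scalerAr. Qed.

HB.instance Definition _ := GRing.isLinear.Build F _ _ _ mulform mulform_linear.

Lemma dim_ideal_part_adjoin I : graded_ideal I ->
  (\dim (ideal_part (adjoin I y) (d + k)) + \dim (ideal_part (colon I y) k) =
   \dim (ideal_part I (d + k)) + \dim (fullv : {vspace hform F n k}))%N.
Proof.
move=> gI; have iI := gI.1; have ia := adjoin_ideal y iI; have ic := colon_ideal y iI.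
pose f := linfun mulform; have fE u : val (f u) = y * val u by rewrite lfunE.
have -> : ideal_part (adjoin I y) (d + k) = (ideal_part I (d + k) + f @: fullv)%VS.
  apply/vspaceP => u; apply/idP/idP.
    move=> /(mem_ideal_part _ ia)[a [b [Ia e]]].
    have hu := dhomog_is_dhomog u.
    have ea : u = DHomog (pihomogP mdeg (d + k) a) + f (DHomog (pihomogP mdeg k b)).
      apply: val_inj; rewrite /= fE /= mulrC -(pihomogM _ _ hy) -linearD /= -e.
      by rewrite pihomog_dE.
    rewrite ea memv_add ?memv_img ?memvf //; apply/(mem_ideal_part _ iI); exact: gI.2.
  case/memv_addP=> v /(mem_ideal_part _ iI) Iv [_ /memv_imgP[w _ ->] ->].
  by apply/(mem_ideal_part _ ia); exists (val v), (val w); rewrite /= fE mulrC.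
have cap : (ideal_part I (d + k) :&: f @: fullv)%VS = (f @: ideal_part (colon I y) k)%VS.
  apply/vspaceP => u; rewrite memv_cap; apply/andP/memv_imgP.
    case=> /(mem_ideal_part _ iI) Iu /memv_imgP[w _ e]; exists w => //.
    by apply/(mem_ideal_part _ ic); rewrite /colon -fE -e.
  case=> w /(mem_ideal_part _ ic) Iw ->; split; last by rewrite memv_img ?memvf.
  by apply/(mem_ideal_part _ iI); rewrite fE.
have ker : (ideal_part (colon I y) k :&: lker f = fullv :&: lker f)%VS.
  rewrite capfv; apply/capv_idPr/subvP => w; rewrite memv_ker => /eqP w0.
  by apply/(mem_ideal_part _ ic); rewrite /colon -fE w0; case: iI.
have arith (a b c e u v w : nat) :
  (u + v = b + e -> a + v = c -> a + e = w -> u + c = b + w)%N by lia.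
have e1 := limg_ker_dim f fullv.
have e2 := limg_ker_dim f (ideal_part (colon I y) k); rewrite ker in e2.
have e3 := dimv_sum_cap (ideal_part I (d + k)) (f @: fullv); rewrite cap in e3.
exact: arith e3 e2 e1.
Qed.

(** Exactness of 0 -> (I : y)/I -> S/I -> S/I -> S/(I, y) -> 0 in degrees [k]
    and [d + k], the middle map being multiplication by [y]. *)
Lemma hilb_adjoin I : graded_ideal I ->
  (hilb (adjoin I y) (d + k) + hilb I k =
   hilb I (d + k) + (\dim (ideal_part (colon I y) k) - \dim (ideal_part I k)))%N.
Proof.
move=> gI; have := dim_ideal_part_adjoin gI; rewrite /hilb.
have iI := gI.1; have ia := adjoin_ideal y iI; have ic := colon_ideal y iI.
have := dimvS (ideal_part_sub (k := k) iI ic (fun p _ => let: And3 _ _ IM := iI in IM y p)).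
have := dimvS (subvf (ideal_part (adjoin I y) (d + k))).
have := dimvS (subvf (ideal_part (colon I y) k)).
have := dimvS (subvf (ideal_part I (d + k))).
lia.
Qed.

Lemma hilb_adjoin_inj I : graded_ideal I ->
  (hilb (adjoin I y) (d + k) + hilb I k = hilb I (d + k))%N <->
  (forall p, p \is k.-homog -> I (y * p) -> I p).
Proof.
move=> gI; have e := hilb_adjoin gI; have iI := gI.1; have ic := colon_ideal y iI.
have sub := ideal_part_sub (k := k) iI ic (fun p _ => let: And3 _ _ IM := iI in IM y p).
split=> [e' p hp Ip|H].
  have eq : ideal_part I k = ideal_part (colon I y) k by apply/eqP; rewrite eqEdim sub /=; lia.
  by apply/(mem_ideal_part (DHomog hp) iI); rewrite eq; apply/(mem_ideal_part _ ic).
by rewrite e; have := dimvS (ideal_part_sub ic iI H); lia.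
Qed.

End Mul.

Lemma hilb_adjoin_lt y d k I : y \is d.-homog -> graded_ideal I -> (k < d)%N ->
  hilb (adjoin I y) k = hilb I k.
Proof.
move=> hy gI kd; have iI := gI.1; have ia := adjoin_ideal y iI.
apply/eqP; rewrite eqn_leq !hilb_le // => [p hp|p _ Ip]; last exact: adjoin_sub.
case=> a [b [Ia e]]; rewrite -(pihomog_dE hp) e linearD /= (pihomogM_lt _ hy kd) addr0.
exact: gI.2.
Qed.

End GradedIdeals.

(** * Regular sequences are detected by the Hilbert function *)

Section Sequences.
Variables (F : fieldType) (n : nat).
Local Notation S := {mpoly F[n]}.
Implicit Types (p q : S) (k d : nat) (s : seq (nat * S)) (u : nat * S).

(** A sequence of forms is given by pairs (degree, form); the degree is recorded
    because the zero form does not determine it. *)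
Definition graded_seq s := all (fun u => (0 < u.1)%N && (u.2 \is u.1.-homog)) s.
Definition ideal_of s : S -> Prop := foldr (fun u I => adjoin I u.2) (fun p => p = 0) s.

Lemma zero_ideal : graded_ideal (fun p => p = 0).
Proof.
split; last by move=> k _ ->; rewrite linear0.
by split=> // [p q -> ->|p q ->]; rewrite ?addr0 ?mulr0.
Qed.

Lemma ideal_of_ideal s : ideal_pred (ideal_of s).
Proof. by elim: s => [|u s IH]; [case: zero_ideal | apply: adjoin_ideal]. Qed.

Lemma ideal_of_graded s : graded_seq s -> graded_ideal (ideal_of s).
Proof.
elim: s => [|u s IH] /=; first by move=> _; exact: zero_ideal.
by case/andP=> /andP[_ hu] /IH gs; apply: adjoin_graded hu.
Qed.

Lemma ideal_of_mem s u : u \in s -> ideal_of s u.2.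
Proof.
elim: s => // v s IH; rewrite inE => /predU1P[->|us] /=.
  exact/adjoin_mem/ideal_of_ideal.
by apply: adjoin_sub; exact: IH.
Qed.

(** The induction principle for membership in a generated ideal; most facts on
    such ideals below are instances, with [J] the preimage of an ideal under a
    ring morphism. *)
Lemma ideal_of_min s (J : S -> Prop) : ideal_pred J -> (forall u, u \in s -> J u.2) ->
  forall p, ideal_of s p -> J p.
Proof.
move=> iJ; have [J0 JD JM] := iJ; elim: s => [|u s IH] sJ p /=; first by move->.
case=> a [b [Ia ->]]; apply: JD; last by apply: JM; apply: sJ; rewrite mem_head.
by apply: IH Ia => v vs; apply: sJ; rewrite inE vs orbT.
Qed.

(** The head of the list is the last element of the regular sequence. *)
Fixpoint regular s : Prop :=
  if s is u :: s' then
    (forall k p, p \is k.-homog -> ideal_of s' (u.2 * p) -> ideal_of s' p) /\ regular s'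
  else True.

(** The factor by which a regular sequence multiplies the Hilbert series: the
    Euler characteristic of its Koszul complex. *)
Definition koszul_poly s : {poly int} := \prod_(u <- s) (1 - 'X^(u.1)).

Definition hilb_ring k : int := (hilb (ideal_of [::]) k)%:Z.

Lemma hilb_cons u s k : graded_seq (u :: s) ->
  convol (1 - 'X^(u.1)) (fun i => (hilb (ideal_of s) i)%:Z) k <= (hilb (ideal_of (u :: s)) k)%:Z.
Proof.
case/andP=> /andP[_ hu] /ideal_of_graded gs; rewrite convol_1subXn /=.
case: leqP => uk; last by rewrite subr0 (hilb_adjoin_lt hu gs uk).
by have := hilb_adjoin (k - u.1) hu gs; rewrite subnKC //; lia.
Qed.

Lemma hilb_cons_inj u s : graded_seq (u :: s) ->
  (forall k, (hilb (ideal_of (u :: s)) k)%:Z =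
     convol (1 - 'X^(u.1)) (fun i => (hilb (ideal_of s) i)%:Z) k) <->
  (forall k p, p \is k.-homog -> ideal_of s (u.2 * p) -> ideal_of s p).
Proof.
case/andP=> /andP[_ hu] /ideal_of_graded gs; split=> [H k|H k].
  apply/(hilb_adjoin_inj k hu gs); have := H (u.1 + k)%N.
  by rewrite convol_1subXn leq_addr addKn /=; lia.
rewrite convol_1subXn /=; case: leqP => uk; last by rewrite subr0 (hilb_adjoin_lt hu gs uk).
have /(hilb_adjoin_inj _ hu gs) := H (k - u.1)%N; rewrite subnKC //; lia.
Qed.

Lemma koszul_poly_cons u s h k :
  convol (koszul_poly (u :: s)) h k = convol (1 - 'X^(u.1)) (convol (koszul_poly s) h) k.
Proof. by rewrite /koszul_poly big_cons convolM. Qed.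

Lemma hilb_regular s : graded_seq s -> regular s ->
  forall k, (hilb (ideal_of s) k)%:Z = convol (koszul_poly s) hilb_ring k.
Proof.
elim: s => [|u s IH] hs rs k; first by rewrite /koszul_poly big_nil convol1.
case: rs => /(hilb_cons_inj hs) -> rs; rewrite koszul_poly_cons.
by apply: convol_ext => i _; apply: IH => //; case/andP: hs.
Qed.

(** In the chain of quotients by longer and longer parts of [s], each step can
    only exceed the predicted Hilbert function.  Dividing by 1 - t^d carries the
    assumed upper bound down to every part, so that all steps are exact. *)
Lemma regular_hilb s : graded_seq s ->
  (forall k, (hilb (ideal_of s) k)%:Z <= convol (koszul_poly s) hilb_ring k) -> regular s.
Proof.
elim: s => // u s IH hs le; have /andP[/andP[u0 _] hs'] := hs.
have le' k : (hilb (ideal_of s) k)%:Z <= convol (koszul_poly s) hilb_ring k.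
  move: k; apply: (convol_1subXn_le u0) => k; apply: le_trans (hilb_cons k hs) _.
  by rewrite -koszul_poly_cons.
have rs := IH hs' le'; split=> //; apply/(hilb_cons_inj hs) => k.
apply/eqP; rewrite eq_le hilb_cons // andbT; apply: le_trans (le k) _.
by rewrite koszul_poly_cons (convol_ext _ (fun i _ => hilb_regular hs' rs i)).
Qed.

Lemma homog_msupp_ideal (J : S -> Prop) p : ideal_pred J ->
  (forall m, m \in msupp p -> J 'X_[m]) -> J p.
Proof.
move=> iJ H; rewrite [p]mpolyE; apply: ideal_pred_sum_seq => // m /H.
by rewrite -mul_mpolyC; case: iJ => _ _; apply.
Qed.

(** For a homogeneous ideal this says that the quotient is finite
    dimensional. *)
Definition cofinite (I : S -> Prop) :=
  exists K, forall k p, (K <= k)%N -> p \is k.-homog -> I p.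

Lemma mdeg_split (m : 'X_{1..n}) j : (j <= mdeg m)%N ->
  exists m1 m2, m = (m1 + m2)%MM /\ mdeg m1 = j.
Proof.
elim: j => [|j IH] jm; first by exists 0%MM, m; rewrite add0m mdeg0.
have [m1 [m2 [e d1]]] := IH (ltnW jm).
have [i i0] : exists i, (0 < m2 i)%N.
  apply/existsP; apply: contraTT jm => /existsPn H; rewrite -ltnNge ltnS e mdegD d1.
  by rewrite [mdeg m2]mdegE big1 ?addn0 // => i _; have := H i; lia.
exists (m1 + U_(i))%MM, (m2 - U_(i))%MM; rewrite mdegD d1 mdeg1 addn1; split=> //.
rewrite e -addmA; congr (_ + _)%MM; apply/mnmP => l; rewrite mnmDE mnmBE mnm1E.
by case: eqP => [<-|_]; lia.
Qed.

Lemma cofinite_deg (I : S -> Prop) K : ideal_pred I ->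
  (forall p, p \is K.-homog -> I p) -> cofinite I.
Proof.
move=> iI H; exists K => k p Kk /dhomogP hp; apply: homog_msupp_ideal => // m mp;
have mk : mdeg m = k := hp m mp.
have [|m1 [m2 [-> d1]]] := @mdeg_split m K; first by rewrite mk.
by rewrite mpolyXD; apply: (ideal_predMr iI); apply: H; rewrite dhomogX; apply/eqP.
Qed.

Lemma cofinite_pow (I : S -> Prop) N : ideal_pred I -> (forall i, I ('X_i ^+ N)) -> cofinite I.
Proof.
move=> iI H; exists (n * N).+1 => k p Kk /dhomogP hp.
apply: homog_msupp_ideal => // m mp; have mk : mdeg m = k := hp m mp.
have [i Ni] : exists i, (N <= m i)%N.
  apply/existsP; apply: contraTT Kk => /existsPn Hm; rewrite -leqNgt -[k]mk mdegE.
  rewrite -[X in (_ <= X * _)%N]card_ord -sum_nat_const; apply: leq_sum => i _.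
  by have := Hm i; lia.
rewrite mpolyXE_id (bigD1 i) //= -(subnKC Ni) exprD.
by do 2!apply: (ideal_predMr iI).
Qed.

End Sequences.

(** * Eliminating a variable by a linear relation *)

Section Generation.
Variables (F : fieldType) (n : nat).
Local Notation S := {mpoly F[n]}.

Lemma mpoly_gen_ind (P : S -> Prop) : (forall c, P c%:MP) -> (forall i, P 'X_i) ->
  (forall p q, P p -> P q -> P (p + q)) -> (forall p q, P p -> P q -> P (p * q)) ->
  forall p, P p.
Proof.
move=> PC PX PD PM p; rewrite [p]mpolyE; elim/big_ind: _ => //; first by rewrite -mpolyC0.
move=> m _; rewrite -mul_mpolyC; apply: (PM) => //; rewrite mpolyXE_id.
elim/big_ind: _ => [|q q'|i _]; [exact: (PC 1) | exact: PM |].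
by elim: (m i) => [|j IH]; [exact: (PC 1) | rewrite exprS; apply: (PM)].
Qed.

Lemma comp_tnth m (lq : n.-tuple {mpoly F[m]}) i : 'X_i \mPo lq = tnth lq i.
Proof. by rewrite comp_mpolyXU -tnth_nth. Qed.

Lemma comp_homog m (lq : n.-tuple {mpoly F[m]}) k (p : S) :
  (forall i, tnth lq i \is 1.-homog) -> p \is k.-homog -> p \mPo lq \is k.-homog.
Proof.
move=> hq /dhomogP hp; rewrite comp_mpolyEX big_seq; apply: rpred_sum => mm /hp mk.
apply: rpredZ; rewrite comp_mpolyX.
have -> : k = (\sum_(i < n) mm i)%N by rewrite -mk -mdegE.
elim/big_ind2: _ => [|a b c d ha hc|i _]; first exact: dhomog1.
  exact: dhomogM.
by have := @dhomogMn _ _ mdeg _ _ (mm i) (hq i); rewrite mul1n.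
Qed.

End Generation.

Section Elimination.
Variables (F : fieldType) (n : nat) (c : 'I_n -> F).
Local Notation S := {mpoly F[n.+1]}.
Local Notation S' := {mpoly F[n]}.
Implicit Types (s : seq (nat * S)) (p : S).

(** A linear form in which the variable 0 has coefficient 1, so that modulo it
    this variable is a combination of the others. *)
Definition linform : S := 'X_ord0 + \sum_(i < n) c i *: 'X_(lift ord0 i).

Definition elim_tuple : n.+1.-tuple S' :=
  [tuple if unlift ord0 i is Some j then 'X_j else - \sum_(j < n) c j *: 'X_j | i < n.+1].
Definition embed_tuple : n.-tuple S := [tuple 'X_(lift ord0 i) | i < n].

Definition eliminate : S -> S' := comp_mpoly elim_tuple.
Definition embed : S' -> S := comp_mpoly embed_tuple.
HB.instance Definition _ := GRing.RMorphism.copy eliminate (comp_mpoly elim_tuple).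
HB.instance Definition _ := GRing.RMorphism.copy embed (comp_mpoly embed_tuple).

Lemma elimC a : eliminate a%:MP = a%:MP. Proof. exact: comp_mpolyC. Qed.
Lemma elimZ a p : eliminate (a *: p) = a *: eliminate p. Proof. exact: comp_mpolyZ. Qed.
Lemma embedC a : embed a%:MP = a%:MP. Proof. exact: comp_mpolyC. Qed.
Lemma elimX0 : eliminate 'X_ord0 = - \sum_(j < n) c j *: 'X_j.
Proof. by rewrite /eliminate comp_tnth tnth_mktuple unlift_none. Qed.
Lemma elimXS i : eliminate 'X_(lift ord0 i) = 'X_i.
Proof. by rewrite /eliminate comp_tnth tnth_mktuple liftK. Qed.
Lemma embedX i : embed 'X_i = 'X_(lift ord0 i).
Proof. by rewrite /embed comp_tnth tnth_mktuple. Qed.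

Lemma elim_linform : eliminate linform = 0.
Proof.
rewrite /linform rmorphD rmorph_sum /= elimX0.
by under [in X in _ + X]eq_bigr => i _ do rewrite elimZ elimXS; rewrite addNr.
Qed.

Lemma embedK : cancel embed eliminate.
Proof.
apply: mpoly_gen_ind => [a|i|p q ep eq|p q ep eq]; first by rewrite embedC elimC.
- by rewrite embedX elimXS.
- by rewrite !rmorphD /= ep eq.
- by rewrite !rmorphM /= ep eq.
Qed.

Lemma elimK_mod p : exists a, p = embed (eliminate p) + a * linform.
Proof.
move: p; apply: mpoly_gen_ind => [a|i|p q [a ep] [b eq]|p q [a ep] [b eq]].
- by exists 0; rewrite elimC embedC mul0r addr0.
- case: (unliftP ord0 i) => [j ->|->].
    by exists 0; rewrite elimXS embedX mul0r addr0.
  exists 1; rewrite elimX0 rmorphN /= rmorph_sum /= mul1r /linform.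
  under eq_bigr => j _ do rewrite [embed _]comp_mpolyZ -/(embed _) embedX.
  by rewrite addrCA addNr addr0.
- by exists (a + b); rewrite !rmorphD /= {1}ep {1}eq; ring.
- exists (a * q + embed (eliminate p) * b); rewrite !rmorphM /= {1}ep mulrDl {1}eq; ring.
Qed.

Lemma linform_homog : linform \is 1.-homog.
Proof.
apply: rpredD; first by rewrite dhomogX; apply/eqP/mdeg1.
by apply: rpred_sum => i _; apply: rpredZ; rewrite dhomogX; apply/eqP/mdeg1.
Qed.

Lemma linform_neq0 : linform != 0.
Proof.
apply/eqP => /(congr1 (mcoeff U_(ord0))) /eqP; rewrite mcoeff0 mcoeffD raddf_sum /=.
rewrite mcoeffXU eqxx big1 ?addr0 ?oner_eq0 // => i _.
by rewrite mcoeffZ mcoeffXU eq_sym (negbTE (neq_lift _ _)) mulr0.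
Qed.

Lemma elim_homog k p : p \is k.-homog -> eliminate p \is k.-homog.
Proof.
apply: comp_homog => i; rewrite tnth_mktuple; case: unliftP => [j _|_].
  by rewrite dhomogX; apply/eqP/mdeg1.
rewrite rpredN; apply: rpred_sum => j _; apply: rpredZ.
by rewrite dhomogX; apply/eqP/mdeg1.
Qed.

Lemma embed_homog k q : q \is k.-homog -> embed q \is k.-homog.
Proof.
apply: comp_homog => i; rewrite tnth_mktuple.
by rewrite dhomogX; apply/eqP/mdeg1.
Qed.

Definition eliminate_seq s := [seq (u.1, eliminate u.2) | u <- s].

Lemma preim_ideal (R R' : comNzRingType) (f : {rmorphism R -> R'}) (J : R' -> Prop) :
  ideal_pred J -> ideal_pred (fun a : R => J (f a)).
Proof.
move=> [J0 JD JM]; split=> [|p q|p q]; first by rewrite rmorph0.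
  by rewrite rmorphD; apply: JD.
by rewrite rmorphM; apply: JM.
Qed.

(** [eliminate] is surjective with kernel generated by [linform c]. *)
Lemma ideal_of_eliminate s p :
  ideal_of ((1%N, linform) :: s) p <-> ideal_of (eliminate_seq s) (eliminate p).
Proof.
have iI := ideal_of_ideal ((1%N, linform) :: s); have [I0 ID IM] := iI.
have iJ := ideal_of_ideal (eliminate_seq s).
have lI : ideal_of ((1%N, linform) :: s) linform by apply: adjoin_mem; exact: ideal_of_ideal.
split.
  apply: (ideal_of_min (J := fun p => ideal_of (eliminate_seq s) (eliminate p)));
    first exact: preim_ideal.
  move=> u; rewrite inE => /predU1P[->|us] /=; first by rewrite elim_linform; case: iJ.
  exact: (ideal_of_mem (map_f (fun u => (u.1, eliminate u.2)) us)).
move=> Jp; have [a ->] := elimK_mod p; apply: ID; last exact: IM.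
move: (eliminate p) Jp.
apply: (ideal_of_min (J := fun q => ideal_of ((1%N, linform) :: s) (embed q)));
  first exact: preim_ideal.
move=> _ /mapP[u us ->] /=; have [b e] := elimK_mod u.2.
have -> : embed (eliminate u.2) = u.2 - b * linform by rewrite {2}e addrK.
apply: (ideal_predB iI); last exact: IM.
by apply: (ideal_of_mem (u := u)); rewrite inE us orbT.
Qed.

Lemma cofinite_eliminate s :
  cofinite (ideal_of ((1%N, linform) :: s)) -> cofinite (ideal_of (eliminate_seq s)).
Proof.
move=> [K H]; exists K => k q Kk hq; rewrite -[q]embedK; apply/ideal_of_eliminate.
by apply: H Kk _; apply: embed_homog.
Qed.

Lemma graded_seq_eliminate s : graded_seq s -> graded_seq (eliminate_seq s).
Proof.
rewrite /graded_seq all_map; apply: sub_all => u /= /andP[-> hu]; exact: elim_homog.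
Qed.

Lemma koszul_poly_eliminate s : koszul_poly (eliminate_seq s) = koszul_poly s.
Proof. by rewrite /koszul_poly big_map. Qed.

Section Form.
Variable k : nat.
Definition elimform (u : hform F n.+1 k) : hform F n k :=
  DHomog (elim_homog (dhomog_is_dhomog u)).

Fact elimform_linear : linear elimform.
Proof. by move=> a u v; apply: val_inj; rewrite /= rmorphD /= elimZ. Qed.
HB.instance Definition _ := GRing.isLinear.Build F _ _ _ elimform elimform_linear.

Lemma hilb_eliminate s :
  hilb (ideal_of ((1%N, linform) :: s)) k = hilb (ideal_of (eliminate_seq s)) k.
Proof.
have iI := ideal_of_ideal ((1%N, linform) :: s); have iJ := ideal_of_ideal (eliminate_seq s).
pose f := linfun elimform; have fE u : val (f u) = eliminate (val u) by rewrite lfunE.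
have onto (v : hform F n k) : exists u, v = f u.
  exists (DHomog (embed_homog (dhomog_is_dhomog v))); apply: val_inj.
  by rewrite fE /= embedK.
have im0 : (f @: fullv)%VS = fullv.
  apply/vspaceP => v; rewrite memvf; have [u ->] := onto v.
  by rewrite memv_img ?memvf.
have im1 : (f @: ideal_part (ideal_of ((1%N, linform) :: s)) k)%VS =
    ideal_part (ideal_of (eliminate_seq s)) k.
  apply/vspaceP => v; apply/memv_imgP/idP.
    case=> u /(mem_ideal_part _ iI) Iu ->; apply/(mem_ideal_part _ iJ); rewrite fE; exact/ideal_of_eliminate.
  have [u ->] := onto v => /(mem_ideal_part _ iJ); rewrite fE => Iu; exists u => //.
  by apply/(mem_ideal_part _ iI)/ideal_of_eliminate.
have ker : (ideal_part (ideal_of ((1%N, linform) :: s)) k :&: lker f = fullv :&: lker f)%VS.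
  rewrite capfv; apply/capv_idPr/subvP => w; rewrite memv_ker => /eqP w0.
  by apply/(mem_ideal_part _ iI)/ideal_of_eliminate; rewrite -fE w0; case: iJ.
have e1 := limg_ker_dim f fullv; rewrite im0 in e1.
have e2 := limg_ker_dim f (ideal_part (ideal_of ((1%N, linform) :: s)) k).
rewrite ker im1 in e2.
have arith (x y z v w : nat) : (x + y = z -> x + v = w -> w - z = v - y)%N by lia.
exact: arith e2 e1.
Qed.

End Form.
End Elimination.

(** The linear form 'X_0 is a nonzerodivisor whose quotient is the polynomial
    ring in one variable less. *)
Lemma hilb_ring_step (F : fieldType) n k : @hilb_ring F n k = convol (1 - 'X) (@hilb_ring F n.+1) k.
Proof.
pose c (i : 'I_n) : F := 0; have hs : graded_seq [:: (1%N, linform c)].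
  by rewrite /graded_seq /= linform_homog.
have := hilb_eliminate c k [::]; rewrite /hilb_ring => <-.
rewrite (hilb_regular hs); first by rewrite /koszul_poly big_seq1 expr1.
split=> // j p _ /= /eqP; rewrite mulf_eq0 (negbTE (linform_neq0 _)).
by move/eqP.
Qed.

Lemma hilb_ring_nvar0 (F : fieldType) k : @hilb_ring F 0 k = (k == 0)%:R.
Proof.
have iI := ideal_of_ideal ([::] : seq (nat * {mpoly F[0]})); rewrite /hilb_ring.
case: k => [|k]; last first.
  suff -> : hilb (ideal_of ([::] : seq (nat * {mpoly F[0]}))) k.+1 = 0%N by [].
  apply/(hilb_eq0 k.+1 iI) => p hp; apply/eqP; apply: contraT => p0.
  by have := dhomog_uniq p0 hp (nvar0_homog _ p).
pose u : hform F 0 0 := DHomog (@dhomog1 0%N F mdeg).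
have e : <[u]>%VS = fullv.
  apply/eqP; rewrite eqEsubv subvf; apply/subvP => v _; apply/vlineP.
  exists ((val v)@_0%MM); apply: val_inj; apply/mpolyP => m /=.
  by rewrite mcoeffZ mcoeff1 (_ : m = 0%MM) ?eqxx ?mulr1 //; apply/mnmP; case.
have u0 : u != 0 by apply/eqP => /(congr1 val) /eqP; rewrite /= oner_eq0.
rewrite /hilb -e dim_vline u0; have -> : ideal_part (ideal_of [::]) 0 = 0%VS :> {vspace hform F 0 0}.
  apply/vspaceP => v; rewrite memv0; apply/idP/eqP => [/(mem_ideal_part _ iI) v0|->].
    exact: val_inj.
  exact: mem0v.
by rewrite dimv0.
Qed.

Lemma hilb_ring_coef (F : fieldType) n k :
  convol ((1 - 'X) ^+ n) (@hilb_ring F n) k = (k == 0)%:R.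
Proof.
elim: n k => [|n IH] k; first by rewrite expr0 convol1 hilb_ring_nvar0.
rewrite exprSr convolM -IH; apply: convol_ext => i _.
by rewrite -hilb_ring_step.
Qed.

(** * Zero divisors in a polynomial ring *)

Section Radical.
Variables (R : comNzRingType) (J : R -> Prop).
Hypothesis iJ : ideal_pred J.

Definition radical a := exists M, J (a ^+ M).

Lemma radical_pow a M N : J (a ^+ M) -> (M <= N)%N -> J (a ^+ N).
Proof. by move=> Ja MN; rewrite -(subnK MN) exprD; case: iJ => _ _; apply. Qed.

Lemma radical_ideal : ideal_pred radical.
Proof.
have [J0 JD JM] := iJ; split; first by exists 1%N; rewrite expr1.
  move=> a b [M Ma] [N Nb]; exists (M + N)%N; rewrite exprDn.
  apply: ideal_pred_sum => // i _; rewrite -mulr_natl; apply: (JM).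
  have [Ni|iN] := leqP N i; first by apply: (JM); exact: radical_pow Nb Ni.
  by apply: (ideal_predMr iJ); apply: radical_pow Ma _; lia.
by move=> a b [M Mb]; exists M; rewrite exprMn; apply: JM.
Qed.

Lemma radical_sub a : J a -> radical a. Proof. by exists 1%N; rewrite expr1. Qed.
End Radical.

(** The coefficients of a zero divisor [l] of R[X]/I[X] act nilpotently on what
    [l] kills.  Such coefficients are reached one by one from the constant one,
    subtracting it and dividing by 'X; nilpotent elements, unlike annihilating
    ones, are stable under this procedure. *)
Section McCoy.
Variables (R : comNzRingType) (I : R -> Prop).
Hypothesis iI : ideal_pred I.
Implicit Types P Q l : {poly R}.

Definition coefs_in P := forall j, I P`_j.

Lemma coefs_in_ideal : ideal_pred coefs_in.
Proof.
have [I0 ID IM] := iI; split=> [j|P Q IP IQ j|P Q IQ j]; first by rewrite coef0.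
  by rewrite coefD; apply: ID.
by rewrite coefM; apply: ideal_pred_sum => // i _; apply: IM.
Qed.

Definition annihilates P l := coefs_in (l * P).

Lemma annihilates_ideal P : ideal_pred (annihilates P).
Proof.
have [J0 JD JM] := coefs_in_ideal.
split=> [|a b|a b]; rewrite /annihilates ?mul0r // ?mulrDl -?mulrA; [exact: JD|exact: JM].
Qed.

Lemma coefs_in_mulXn M P : coefs_in ('X^M * P) -> coefs_in P.
Proof. by move=> H j; have := H (M + j)%N; rewrite coefXnM ltnNge leq_addr addKn. Qed.

(** On [P] and up to [I], multiplication by [a] is multiplication by
    [- l * 'X].  So [a ^+ size P * P] is divisible by ['X ^+ size P] up to [I],
    while its size is at most [size P]. *)
Lemma annihilates_const_coef a l P : coefs_in ((l * 'X + a%:P) * P) ->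
  coefs_in (a%:P ^+ size P * P).
Proof.
move=> H j; case: (ltnP j (size P)) => jP; last first.
  by rewrite -polyC_exp coefCM nth_default // mulr0; case: iI.
have iP := coefs_in_ideal.
suff /(_ j) : coefs_in (a%:P ^+ size P * P - (- (l * 'X)) ^+ size P * P).
  have -> : - (l * 'X) = 'X * (- l) by rewrite mulrN mulrC.
  by rewrite coefB exprMn -!mulrA coefXnM jP subr0.
rewrite -mulrBl subrXX mulrAC opprK [a%:P + _]addrC.
exact: (ideal_predMr iP).
Qed.

Lemma annihilates_const_rad a l N : forall P, coefs_in ((l * 'X + a%:P) ^+ N * P) ->
  exists M, coefs_in (a%:P ^+ M * P).
Proof.
elim: N => [|N IH] P; first by rewrite expr0 mul1r; exists 0%N; rewrite expr0 mul1r.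
rewrite exprS -mulrA => /annihilates_const_coef; rewrite mulrCA => /IH [M].
by rewrite mulrA -exprD; eexists; eassumption.
Qed.

Lemma annihilates_coef l :
  forall P, radical (annihilates P) l -> forall j, radical (annihilates P) (l`_j)%:P.
Proof.
elim/poly_ind: l => [|l a IH] P rl j.
  by rewrite coef0; case: (radical_ideal (annihilates_ideal P)).
have [r0 rD rM] := radical_ideal (annihilates_ideal P).
have [M aM] : radical (annihilates P) a%:P.
  by case: rl => N /annihilates_const_rad[M]; exists M.
rewrite coefD coefC coefMX; case: j => [|j] /=.
  by rewrite add0r; exists M.
rewrite addr0; apply: IH.
have [N lN] : radical (annihilates P) (l * 'X).
  rewrite -[_ * 'X](addrK a%:P); apply: (ideal_predB (radical_ideal (annihilates_ideal P))) => //.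
  by exists M.
by exists N; apply: (@coefs_in_mulXn N); rewrite mulrA -exprMn ['X * l]mulrC.
Qed.

End McCoy.

(** * Extending scalars to F(t); the generic linear form *)

Lemma frac_denom (R : idomainType) (x : {fraction R}) :
  exists2 q : R, q != 0 & exists a, FracField.tofrac q * x = FracField.tofrac a.
Proof.
pose r := repr x; exists \d_r; first exact: denom_ratioP.
exists \n_r; rewrite -[x]reprK -/r; unlock FracField.tofrac.
rewrite -[LHS]FracField.pi_mul; apply/eqmodP; rewrite /= FracField.equivfE /FracField.mulf.
by rewrite !numden_Ratio ?mul1r ?mulr1 ?oner_eq0 ?denom_ratioP // mulrC.
Qed.

(** [K] stands for the field F(t) of fractions of {poly F}, [e] for the
    inclusion of F[t]. *)
Section Extension.
Variables (F K : fieldType) (e : {rmorphism {poly F} -> K}).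
Hypothesis e_inj : forall q, e q = 0 -> q = 0.
Hypothesis e_frac : forall x, exists2 q, q != 0 & exists a, e q * x = e a.
Variable n : nat.
Local Notation S := {mpoly F[n]}.
Local Notation SK := {mpoly K[n]}.
Implicit Types (p : S) (g : SK) (P Q : {poly S}) (q : {poly F}) (s : seq (nat * S)).

Definition extend : S -> SK := map_mpoly (e \o polyC).
HB.instance Definition _ := GRing.RMorphism.copy extend (map_mpoly (e \o polyC)).

(** The inclusion of F[x][t] into F(t)[x]; up to denominators in F[t], every
    element of F(t)[x] comes from there. *)
Definition evalt : {poly S} -> SK :=
  horner_morph (fun p => mulrC (e 'X)%:MP_[n] (extend p)).
HB.instance Definition _ := GRing.RMorphism.copy evalt
  (horner_morph (fun p => mulrC (e 'X)%:MP_[n] (extend p))).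

Definition scalt : {poly F} -> {poly S} := map_poly (@mpolyC n F).
HB.instance Definition _ := GRing.RMorphism.copy scalt (map_poly (@mpolyC n F)).

Lemma evaltC p : evalt p%:P = extend p. Proof. exact: horner_morphC. Qed.
Lemma evaltX : evalt 'X = (e 'X)%:MP. Proof. exact: horner_morphX. Qed.
Lemma extendC a : extend a%:MP = (e a%:P)%:MP. Proof. exact: map_mpolyC. Qed.
Lemma extendX m : extend 'X_[m] = 'X_[m]. Proof. exact: map_mpolyX. Qed.

Lemma evaltE P : evalt P = \sum_(j < size P) (e 'X ^+ j)%:MP * extend P`_j.
Proof.
rewrite -{1}[P]coefK poly_def rmorph_sum; apply: eq_bigr => j _ /=.
by rewrite -mul_polyC rmorphM rmorphXn /= evaltC evaltX rmorphXn mulrC.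
Qed.

Lemma evalt_scalt q : evalt (scalt q) = (e q)%:MP.
Proof.
elim/poly_ind: q => [|q a IH]; first by rewrite !rmorph0.
rewrite !rmorphD !rmorphM /= IH {1}/scalt map_polyX evaltX.
by rewrite /scalt map_polyC evaltC extendC.
Qed.

Lemma evalt_coef P m : (evalt P)@_m = e (\poly_(j < size P) (P`_j)@_m).
Proof.
rewrite evaltE raddf_sum poly_def rmorph_sum; apply: eq_bigr => j _ /=.
by rewrite mcoeffCM mcoeff_map_mpoly -mul_polyC rmorphM rmorphXn mulrC.
Qed.

Lemma evalt_inj : injective evalt.
Proof.
move=> P Q /eqP; rewrite -subr_eq0 -rmorphB /= => /eqP e0; apply/eqP; rewrite -subr_eq0.
apply/eqP/polyP => j; rewrite coef0; apply/mpolyP => m; rewrite mcoeff0.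
have /e_inj/(congr1 (coefp j)) := etrans (esym (evalt_coef (P - Q) m))
  (etrans (congr1 (mcoeff m) e0) (mcoeff0 _ m)).
rewrite /= coef_poly coef0; case: ltnP => // jP _.
by rewrite nth_default // mcoeff0.
Qed.

Lemma extend_homog k p : p \is k.-homog -> extend p \is k.-homog.
Proof.
move=> /dhomogP hp; apply/dhomogP => m; rewrite mcoeff_msupp mcoeff_map_mpoly => pm.
by apply: hp; rewrite mcoeff_msupp; apply: contraNneq pm => ->; rewrite /= rmorph0.
Qed.

(** The extension of [J] from F to F(t): clearing denominators leaves a
    polynomial in t with coefficients in [J]. *)
Definition lifts (J : S -> Prop) g :=
  exists q P, [/\ q != 0, (e q)%:MP * g = evalt P & forall j, J P`_j].

Lemma scalt_coef (J : S -> Prop) q P : subspace_pred J -> (forall j, J P`_j) ->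
  forall j, J (scalt q * P)`_j.
Proof.
move=> [J0 JD JZ] JP j; rewrite coefM; elim/big_ind: _ => // i _.
by rewrite coef_map /= mul_mpolyC; apply: JZ.
Qed.

Lemma lifts_subspace (J : S -> Prop) : subspace_pred J -> subspace_pred (lifts J).
Proof.
move=> sJ; have [J0 JD JZ] := sJ; split.
- exists 1, 0; rewrite oner_eq0 mulr0 rmorph0; split=> // j.
  by rewrite coef0.
- move=> g h [q [P [q0 eP JP]]] [r [Q [r0 eQ JQ]]].
  exists (q * r), (scalt r * P + scalt q * Q); rewrite mulf_neq0 //; split=> // [|j].
    by rewrite rmorphD !rmorphM /= !evalt_scalt -eP -eQ; ring.
  by rewrite coefD; apply: JD; apply: scalt_coef.
- move=> x g [q [P [q0 eP JP]]]; have [r r0 [a ea]] := e_frac x.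
  exists (r * q), (scalt a * P); rewrite mulf_neq0 //; split=> // [|j]; last exact: scalt_coef.
  by rewrite !rmorphM /= !evalt_scalt -eP -ea !rmorphM /= -mul_mpolyC; ring.
Qed.

Lemma lifts_extend (J : S -> Prop) p : J 0 -> J p -> lifts J (extend p).
Proof.
move=> J0 Jp; exists 1, p%:P; rewrite oner_eq0 rmorph1 evaltC mul1r; split=> // j.
by rewrite coefC; case: ifP.
Qed.

Lemma ideal_subspace m (F' : fieldType) (J : {mpoly F'[m]} -> Prop) :
  ideal_pred J -> subspace_pred J.
Proof. by case=> J0 JD JM; split=> // a u Ju; rewrite -mul_mpolyC; apply: JM. Qed.

Lemma lifts_ideal (J : S -> Prop) : ideal_pred J -> ideal_pred (lifts J).
Proof.
move=> iJ; have sJ := ideal_subspace iJ; have [L0 LD LZ] := lifts_subspace sJ; split=> //.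
move=> h g Lg; rewrite [h]mpolyE mulr_suml; elim/big_ind: _ => // m _.
rewrite -scalerAl; apply: LZ; case: Lg => q [P [q0 eP JP]].
exists q, ('X_[m]%:P * P); split=> // [|j]; first by rewrite rmorphM /= evaltC extendX -eP mulrCA.
by rewrite coefCM; case: iJ => _ _; apply.
Qed.

Definition extend_seq s := [seq (u.1, extend u.2) | u <- s].

Lemma ideal_of_lifts s g : ideal_of (extend_seq s) g -> lifts (ideal_of s) g.
Proof.
apply: ideal_of_min; first exact/lifts_ideal/ideal_of_ideal.
move=> _ /mapP[u us ->] /=; apply: lifts_extend; last exact: ideal_of_mem.
by case: (ideal_of_ideal s).
Qed.

Lemma ideal_of_extend s p : ideal_of s p -> ideal_of (extend_seq s) (extend p).
Proof.
apply: (ideal_of_min (J := fun p => ideal_of (extend_seq s) (extend p))).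
  exact: (preim_ideal extend (ideal_of_ideal _)).
by move=> u us; apply: (ideal_of_mem (map_f (fun u => (u.1, extend u.2)) us)).
Qed.

(** Faithful flatness of F(t) over F: compare leading coefficients in t after
    clearing denominators. *)
Lemma ideal_of_contract s p : ideal_of (extend_seq s) (extend p) -> ideal_of s p.
Proof.
case/ideal_of_lifts=> q [P [q0 eP JP]]; have := JP (size q).-1.
have <- : scalt q * p%:P = P.
  by apply: evalt_inj; rewrite rmorphM /= evalt_scalt evaltC.
rewrite coefMC coef_map /= -lead_coefE mul_mpolyC => Ip.
have /(_ (lead_coef q)^-1 _ Ip) : forall a r, ideal_of s r -> ideal_of s (a *: r).
  by case: (ideal_subspace (ideal_of_ideal s)).
by rewrite scalerA mulVf ?lead_coef_eq0 // scale1r.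
Qed.

Lemma graded_seq_extend s : graded_seq s -> graded_seq (extend_seq s).
Proof.
rewrite /graded_seq all_map; apply: sub_all => u /= /andP[-> hu]; exact: extend_homog.
Qed.

Lemma regular_contract s : regular (extend_seq s) -> regular s.
Proof.
elim: s => // u s IH /= [reg /IH rs]; split=> // k p hp Ip.
apply: ideal_of_contract; apply: reg (extend_homog hp) _.
by rewrite -rmorphM; apply: ideal_of_extend.
Qed.

Lemma cofinite_extend s : cofinite (ideal_of s) -> cofinite (ideal_of (extend_seq s)).
Proof.
move=> [M H]; exists M => k p Mk /dhomogP hp.
apply: homog_msupp_ideal; first exact: ideal_of_ideal.
move=> m /hp mk; rewrite -extendX; apply: ideal_of_extend; apply: H Mk _.
by rewrite dhomogX; apply/eqP.
Qed.

Lemma homog_lifts k g : g \is k.-homog -> lifts (fun p => p \is k.-homog) g.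
Proof.
move=> /dhomogP hg.
have sJ : subspace_pred (fun p => p \is k.-homog).
  by split=> [|u v hu hv|a u hu]; [exact: dhomog0 | exact: rpredD | exact: rpredZ].
have [L0 LD LZ] := lifts_subspace sJ.
rewrite [g]mpolyE big_seq; elim/big_ind: _ => // m /hg mk.
apply: LZ; rewrite -extendX; apply: lifts_extend; first exact: dhomog0.
by rewrite dhomogX; apply/eqP.
Qed.

End Extension.

Section Generic.
Variables (F K : fieldType) (e : {rmorphism {poly F} -> K}).
Hypothesis e_inj : forall q, e q = 0 -> q = 0.
Hypothesis e_frac : forall x, exists2 q, q != 0 & exists a, e q * x = e a.
Variable n : nat.
Local Notation S := {mpoly F[n.+1]}.

Definition generic_form : {mpoly K[n.+1]} := linform (fun i : 'I_n => e 'X ^+ i.+1).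

Lemma evalt_generic_form :
  evalt e (\sum_(i < n.+1) ('X_i : S)%:P * 'X^i) = generic_form.
Proof.
have H (i : 'I_n.+1) : evalt e (('X_i : S)%:P * 'X^i) = e 'X ^+ i *: 'X_i.
  by rewrite rmorphM rmorphXn /= evaltC evaltX extendX -mul_mpolyC rmorphXn mulrC.
rewrite rmorph_sum /= (eq_bigr _ (fun i _ => H i)) big_ord_recl /= expr0 scale1r.
by [].
Qed.

Lemma generic_form_coef (i : 'I_n.+1) : (\sum_(j < n.+1) ('X_j : S)%:P * 'X^j)`_i = 'X_i.
Proof.
rewrite coef_sum (bigD1 i) //= coefCM coefXn eqxx mulr1 big1 ?addr0 // => j ji.
by rewrite coefCM coefXn eq_sym (inj_eq val_inj) (negbTE ji) mulr0.
Qed.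

(** Clear denominators to bring the relation into F[x][t].  The coefficients in t
    of the generic form are the variables, so every variable, and with them [y],
    is nilpotent on what it kills; but [y] is injective in these degrees. *)
Lemma generic_form_inj (s : seq (nat * S)) (y : S) d k0 : (0 < d)%N -> y \is d.-homog ->
  (forall k p, (k0 <= k)%N -> p \is k.-homog -> ideal_of s (y * p) -> ideal_of s p) ->
  forall k p, (k0 <= k)%N -> p \is k.-homog ->
    ideal_of (extend_seq e s) (generic_form * p) -> ideal_of (extend_seq e s) p.
Proof.
move=> d0 hy y_inj k p kk0 hp Lp; have iI := ideal_of_ideal s.
have [q1 [P1 [q10 eP1 hP1]]] := homog_lifts e_frac hp.
have [q2 [Q [q20 eQ IQ]]] := ideal_of_lifts e_frac Lp.
pose P := scalt n.+1 q2 * P1; pose l : {poly S} := \sum_(i < n.+1) ('X_i : S)%:P * 'X^i.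
have hP j : P`_j \is k.-homog.
  apply: (scalt_coef (J := fun p => p \is k.-homog)) => //.
  by split=> [|u v hu hv|a u hu]; [exact: dhomog0 | exact: rpredD | exact: rpredZ].
have eP : evalt e P = (e q2 * e q1)%:MP * p by rewrite rmorphM /= evalt_scalt -eP1 mulrA mpolyCM.
have lP : coefs_in (ideal_of s) (l * P).
  have -> : l * P = scalt n.+1 q1 * Q.
    apply: (evalt_inj e_inj); rewrite rmorphM /= evalt_generic_form eP [RHS]rmorphM /= evalt_scalt -eQ.
    by rewrite mpolyCM; ring.
  exact: (scalt_coef _ (ideal_subspace iI)).
have iA := annihilates_ideal iI P; have iR := radical_ideal iA.
have radX i : radical (annihilates (ideal_of s) P) ('X_i : S)%:P.
  by rewrite -generic_form_coef; apply: annihilates_coef => //; apply: radical_sub.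
have [M yM] : radical (annihilates (ideal_of s) P) y%:P.
  apply: (homog_msupp_ideal (J := fun a => radical (annihilates (ideal_of s) P) a%:P)).
    exact: (preim_ideal polyC iR).
  move=> m my; have /dhomogP/(_ m my) md := hy.
  have {}md : mdeg m = d := md.
  have [|m1 [m2 [-> d1]]] := @mdeg_split n.+1 m 1; first by rewrite md.
  have /mdeg1P[i /eqP ->] : mdeg m1 == 1%N by apply/eqP.
  by rewrite mpolyXD polyCM; apply: (ideal_predMr iR).
have IP j : ideal_of s P`_j.
  have := yM j; rewrite -polyC_exp coefCM.
  elim: (M) => [|N IH]; first by rewrite expr0 mul1r.
  rewrite exprS -mulrA => H; apply: IH; apply: y_inj H; last first.
    by apply: dhomogM (hP j); apply: dhomogMn hy.
  exact: leq_trans kk0 (leq_addl _ _).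
have iK := ideal_of_ideal (extend_seq e s); have [_ _ IM] := iK.
have : ideal_of (extend_seq e s) (evalt e P).
  rewrite evaltE; apply: ideal_pred_sum => // j _; apply: IM; exact: ideal_of_extend.
have q0 : e q2 * e q1 != 0.
  by rewrite mulf_neq0 //; [move: q20 | move: q10]; apply: contra_neq; exact: e_inj.
rewrite eP => /(IM (e q2 * e q1)^-1%:MP).
by rewrite mulrA -mpolyCM mulVf // mpolyC1 mul1r.
Qed.

End Generic.

(** * Systems of parameters of a polynomial ring *)

(** The sum of [d] consecutive values of [u] is eventually nonincreasing, hence
    eventually constant; its increments are the differences
    [u (d + k) - u k]. *)
Lemma eventually_periodic (u : nat -> nat) d K : 
  (forall k, (K <= k)%N -> (u (d + k) <= u k)%N) ->
  exists K', forall k, (K' <= k)%N -> u (d + k)%N = u k.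
Proof.
move=> H; pose w k := (\sum_(i < d) u (i + k))%N.
have wS k : (w k.+1 + u k = w k + u (d + k))%N.
  transitivity (\sum_(i < d.+1) u (i + k))%N; last by rewrite big_ord_recr.
  rewrite big_ord_recl add0n addnC; congr (_ + _)%N.
  by apply: eq_bigr => i _; rewrite /= /bump add1n addnS.
have wmono k k' : (K <= k)%N -> (k <= k')%N -> (w k' <= w k)%N.
  move=> Kk; elim: k' => [|k' IH]; first by rewrite leqn0 => /eqP->.
  rewrite leq_eqVlt => /predU1P[<-//|kk']; have := wS k'.
  by have := H k' (leq_trans Kk kk'); have := IH kk'; lia.
have [v v_min] : exists v, (exists2 k, (K <= k)%N & w k = v) /\
    forall k, (K <= k)%N -> (v <= w k)%N.
  pose Q v := `[< exists2 k, (K <= k)%N & w k = v >].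
  have exQ : exists v, Q v by exists (w K); apply/asboolP; exists K.
  case: (ex_minnP exQ) => v /asboolP vk vmin; exists v; split=> // k Kk.
  by apply: vmin; apply/asboolP; exists k.
case: v_min => -[k0 Kk0 wk0] vmin; exists k0 => k kk0.
have Kk := leq_trans Kk0 kk0.
have := wS k; have := vmin k Kk; have := vmin k.+1 (leqW Kk).
have := wmono _ _ Kk0 kk0; have := wmono _ _ Kk0 (leqW kk0); lia.
Qed.

(** In large degrees nothing is left modulo the whole sequence, so multiplication
    by its last form is onto.  Dimensions then cannot grow, so they become
    periodic and multiplication becomes injective as well. *)
Lemma cofinite_last (F : fieldType) n (u : nat * {mpoly F[n]}) s :
  graded_seq (u :: s) -> cofinite (ideal_of (u :: s)) ->
  exists K, forall k, (K <= k)%N ->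
    hilb (ideal_of s) (u.1 + k) = hilb (ideal_of s) k /\
    forall p, p \is k.-homog -> ideal_of s (u.2 * p) -> ideal_of s p.
Proof.
move=> hs [K cof]; have /andP[/andP[u0 hu] hs'] := hs; have gs := ideal_of_graded hs'.
have h0 k : (K <= k)%N -> hilb (ideal_of (u :: s)) (u.1 + k) = 0%N.
  move=> Kk; apply/hilb_eq0; first exact: ideal_of_ideal.
  by move=> p; apply: cof; apply: leq_trans Kk (leq_addl _ _).
have [K' per] : exists K', forall k, (K' <= k)%N -> hilb (ideal_of s) (u.1 + k) = hilb (ideal_of s) k.
  apply: (@eventually_periodic _ _ K) => k Kk.
  by have := hilb_adjoin k hu gs; have /= -> := h0 k Kk; lia.
exists (maxn K K') => k; rewrite geq_max => /andP[Kk K'k]; split; first exact: per.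
by apply/(hilb_adjoin_inj k hu gs); have /= -> := h0 k Kk; rewrite per.
Qed.

(** A case of Macaulay's unmixedness theorem.  The field varies in the
    induction because each step passes to F(t). *)
Theorem cofinite_regular n (F : fieldType) (s : seq (nat * {mpoly F[n]})) :
  size s = n -> graded_seq s -> cofinite (ideal_of s) -> regular s.
Proof.
elim: n F s => [|n IH] F [//|u s] // [szs] hs cof.
pose K := {fraction {poly F}}; pose e : {rmorphism {poly F} -> K} := @FracField.tofrac {poly F}.
have e_inj q : e q = 0 -> q = 0 by move/eqP; rewrite tofrac_eq0 => /eqP.
have e_frac : forall x : K, exists2 q, q != 0 & exists a, e q * x = e a := @frac_denom _.
have /andP[/andP[u0 hu] hs'] := hs.
pose L := generic_form e n; pose sK := extend_seq e s.
have hK : graded_seq ((u.1, extend e u.2) :: sK) := graded_seq_extend e hs.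
have [_ hsK] := andP hK; have gK := ideal_of_graded hsK.
(* Let J be the ideal of s.  From degree k0 on, u.2 is injective on S/J over F,
   which controls the generic form; from degree k1 on, the Hilbert function of
   S/J over F(t) is periodic. *)
have [k0 last0] := cofinite_last hs cof.
have [k1 last1] := cofinite_last hK (cofinite_extend e cof).
have L_inj k p : (k0 <= k)%N -> p \is k.-homog -> ideal_of sK (L * p) -> ideal_of sK p.
  by apply: (generic_form_inj e_inj e_frac u0 hu) => j q /last0[_]; apply.
have hL : L \is 1.-homog by exact: linform_homog.
have hLs : graded_seq ((1%N, L) :: sK) by rewrite /graded_seq /= hL.
have grow k : (k0 <= k)%N -> (hilb (ideal_of sK) k <= hilb (ideal_of sK) k.+1)%N.
  move=> k0k; have := hilb_adjoin k hL gK; have := (hilb_adjoin_inj k hL gK).2.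
  by rewrite add1n => H; have := H (fun p => L_inj k p k0k); lia.
(* The Hilbert function of S/J over F(t) is nondecreasing and periodic, hence
   constant, from degree maxn k0 k1 on: so L is onto there. *)
have cofL : cofinite (ideal_of ((1%N, L) :: sK)).
  pose k := maxn k0 k1; apply: (cofinite_deg (K := k.+1)); first exact: ideal_of_ideal.
  apply/hilb_eq0; first exact: ideal_of_ideal.
  have le j : (hilb (ideal_of sK) k.+1 <= hilb (ideal_of sK) (j.+1 + k))%N.
    elim: j => // j IHj; apply: leq_trans IHj (grow _ _).
    by rewrite /k; lia.
  have /(hilb_adjoin_inj k hL gK).2 :
      forall p, p \is k.-homog -> ideal_of sK (L * p) -> ideal_of sK p.
    by move=> p; apply: L_inj; rewrite leq_maxl.
  have [/= per _] := last1 k (leq_maxr _ _); have := le u.1.-1.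
  by rewrite add1n prednK //= -/sK per; lia.
have hE : graded_seq (eliminate_seq (fun i => e 'X ^+ i.+1) sK) := graded_seq_eliminate _ hsK.
have rE := IH K _ (etrans (size_map _ _) (etrans (size_map _ _) szs)) hE (cofinite_eliminate cofL).
(* Eliminating the variable 0 turns the quotient by J and L into one whose Hilbert
   function is known by induction, and it is the one a regular sequence has. *)
have [regL regs] : regular ((1%N, L) :: sK).
  apply: regular_hilb => // k; rewrite /L /generic_form hilb_eliminate (hilb_regular hE rE).
  rewrite koszul_poly_eliminate koszul_poly_cons -convolM mulrC expr1 convolM le_eqVlt;
  apply/orP; left.
  by apply/eqP; apply: convol_ext => i _; rewrite hilb_ring_step.
apply: (regular_contract e_inj e_frac); split=> // k p hp Ip.
have [_ IM] : [/\ True & forall a q, ideal_of sK q -> ideal_of sK (a * q)]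
  by case: (ideal_of_ideal sK).
(* L ^+ k1 moves p into degrees where u.2 is injective, and L is injective in all
   degrees. *)
suff drop j : ideal_of sK (L ^+ j * p) -> ideal_of sK p.
  have hLp : L ^+ k1 * p \is (k1 + k).-homog.
    by have := dhomogM (dhomogMn k1 hL) hp; rewrite mul1n.
  have [_ inj1] := last1 (k1 + k)%N (leq_addr _ _).
  by apply: (drop k1); apply: inj1 => //; rewrite mulrCA; apply: IM.
elim: j => [|j IHj]; first by rewrite mul1r.
rewrite exprS -mulrA => /(regL (1 * j + k)%N) H; apply/IHj/H.
by apply: dhomogM hp; apply: dhomogMn.
Qed.

Section CompleteIntersection.
Variables (F : fieldType) (n : nat).
Implicit Types (s : seq (nat * {mpoly F[n]})).

(** The Hilbert series, here a polynomial, of a complete intersection of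
    dimension 0. *)
Definition ci_poly s : {poly int} := \prod_(u <- s) \sum_(j < u.1) 'X^j.

Lemma koszul_poly_ci s : koszul_poly s = ci_poly s * (1 - 'X) ^+ size s.
Proof.
rewrite /koszul_poly /ci_poly; elim: s => [|u s IH]; first by rewrite !big_nil mulr1.
rewrite !big_cons IH /= exprS -opprB subrX1 -mulNr opprB.
ring.
Qed.

Theorem hilb_parameters s : size s = n -> graded_seq s -> cofinite (ideal_of s) ->
  forall k, (hilb (ideal_of s) k)%:Z = (ci_poly s)`_k.
Proof.
move=> szs hs cof k; rewrite (hilb_regular hs (cofinite_regular szs hs cof)).
rewrite koszul_poly_ci szs convolM -convol_delta; apply: convol_ext => i _.
exact: hilb_ring_coef.
Qed.

Lemma ci_poly_monic s : graded_seq s ->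
  ci_poly s \is monic /\ size (ci_poly s) = (\sum_(u <- s) (u.1 - 1)).+1.
Proof.
rewrite /ci_poly; elim: s => [|u s IH] /=; first by rewrite !big_nil monic1 size_poly1.
case/andP=> /andP[u0 _] /IH[ms szs]; rewrite !big_cons.
have sz : size (\sum_(j < u.1) 'X^j : {poly int}) = u.1.
  case: (u.1) u0 => // d _; rewrite big_ord_recr /= addrC size_polyDl size_polyXn //.
  rewrite ltnS; apply: leq_trans (size_sum _ _ _) _; apply/bigmax_leqP => i _.
  by rewrite size_polyXn.
have mu : (\sum_(j < u.1) 'X^j : {poly int}) \is monic.
  rewrite monicE lead_coefE sz; case: (u.1) u0 => // d _.
  rewrite coef_sum (bigD1 ord_max) //= coefXn eqxx big1 ?addr0 // => j jd.
  by rewrite coefXn eq_sym (negbTE (jd : val j != val ord_max)).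
split; first by rewrite monicMl.
by rewrite size_Mmonic ?monic_neq0 // sz szs; lia.
Qed.

Lemma ci_poly_horner1 s : (ci_poly s).[1] = (\prod_(u <- s) u.1)%:Z.
Proof.
rewrite /ci_poly horner_prod -[RHS]natz natr_prod; apply: eq_bigr => u _.
rewrite horner_sum (eq_bigr (fun _ => 1)) ?sumr_const ?card_ord ?natz // => i _.
by rewrite hornerXn expr1n.
Qed.

End CompleteIntersection.

(** * The Hilbert ideal *)

Lemma bij_vector_axiom (F : fieldType) (V : lmodType F) m (g : 'rV[F]_m -> V) :
  linear g -> (forall r, g r = 0 -> r = 0) -> (forall x, exists r, g r = x) ->
  inhabited (Vector.axiom m V).
Proof.
move=> glin g0 gonto; pose h x := projT1 (cid (gonto x)).
have hK : cancel h g by move=> x; rewrite /h; case: (cid _).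
have ginj : injective g.
  move=> r r' e; apply/eqP; rewrite -subr_eq0; apply/eqP/g0.
  by rewrite addrC -scaleN1r glin scaleN1r e addNr.
constructor; exists h; last by exists g => // r; apply: ginj; rewrite hK.
by move=> c u v; apply: ginj; rewrite glin !hK.
Qed.

(** The numbers [t] and [m] below are the top degree and the dimension of S/H for
    a homogeneous ideal [H]; they are compared with those of S/(s) for a system
    of parameters [s] contained in [H]. *)
Section TopDegree.
Variables (F : fieldType) (n : nat) (H : {mpoly F[n]} -> Prop) (t K : nat).
Hypotheses (iH : ideal_pred H) (ht : hilb H t != 0)
  (t_max : forall k, hilb H k != 0 -> (k <= t)%N)
  (hK : forall k, (K <= k)%N -> hilb H k = 0%N).
Local Notation m := (\sum_(k < K) hilb H k)%N.

Lemma parameters_bound s : size s = n -> graded_seq s -> cofinite (ideal_of s) ->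
  (forall p, ideal_of s p -> H p) ->
  [/\ (t <= \sum_(u <- s) (u.1 - 1))%N, (m <= \prod_(u <- s) u.1)%N &
     (forall p, H p -> ideal_of s p) ->
       t = (\sum_(u <- s) (u.1 - 1))%N /\ m = (\prod_(u <- s) u.1)%N].
Proof.
move=> szs hs cof sH; have hE := hilb_parameters szs hs cof; have iI := ideal_of_ideal s.
have [mon sz] := ci_poly_monic hs.
have le k : (hilb H k <= hilb (ideal_of s) k)%N by apply: hilb_le => // p _; apply: sH.
have total : (\sum_(k < maxn K (size (ci_poly s))) hilb (ideal_of s) k = \prod_(u <- s) u.1)%N.
  apply/eqP; rewrite -eqz_nat -ci_poly_horner1 (horner_coef_wide _ (leq_maxr K _)).
  rewrite -natz natr_sum; apply/eqP; apply: eq_bigr => k _.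
  by rewrite expr1n mulr1 natz hE.
have mE : m = (\sum_(k < maxn K (size (ci_poly s))) hilb H k)%N.
  rewrite (big_ord_widen (maxn K (size (ci_poly s))) (fun k => hilb H k) (leq_maxl K _)) big_mkcond /=.
  by apply: eq_bigr => k _; case: ltnP => // /hK.
have tle : (t <= \sum_(u <- s) (u.1 - 1))%N.
  rewrite -ltnS -sz ltnNge; apply: contra ht => szt.
  by have := hE t; rewrite nth_default // => -[h0]; rewrite -leqn0 -h0.
split=> //; first by rewrite mE -total; apply: leq_sum.
move=> Hs; have heq k : hilb H k = hilb (ideal_of s) k.
  by apply/eqP; rewrite eqn_leq le hilb_le // => p _; apply: Hs.
split; last by rewrite mE -total; apply: eq_bigr => k _.
apply/eqP; rewrite eqn_leq tle t_max // heq.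
have := hE (\sum_(u <- s) (u.1 - 1))%N; move/monicP: mon; rewrite lead_coefE sz /= => ->.
by case=> ->.
Qed.

End TopDegree.

Section HilbertIdeal.
Variables (F : fieldType) (gT : finGroupType) (G : {group gT}) (n : nat).
Variable rG : mx_representation F G n.
Local Notation S := {mpoly F[n]}.
Local Notation H := (in_hilbert_ideal rG).

Lemma hilbert_ideal_pred : ideal_pred H.
Proof.
have HP p : reflect (H p) (p \in hilbert_ideal rG) := asboolP _.
have [/HP H0 _ HD] := hilbert_ideal_idealr rG.
split=> // [p q /HP Hp /HP Hq|p q /HP Hq]; apply/HP.
  by rewrite -[p]mul1r; apply: HD.
by rewrite -[p * q]addr0; apply: HD => //; apply/HP.
Qed.

Lemma hilbert_ideal1 : ~ H 1.
Proof. by have [_ /negP H1 _] := hilbert_ideal_idealr rG => /asboolP/H1. Qed.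

Lemma hilbert_ideal_min (J : S -> Prop) : ideal_pred J ->
  (forall u, pos_invariant rG u -> J u) -> forall p, H p -> J p.
Proof.
move=> iJ uJ _ [k [a [u [hu ->]]]]; apply: ideal_pred_sum => // i _.
by case: iJ => _ _; apply; apply: uJ.
Qed.

Lemma pos_invariant_mem u : pos_invariant rG u -> H u.
Proof.
by move=> hu; exists 1%N, (fun _ => 1), (fun _ => u); rewrite big_ord1 mul1r.
Qed.

Lemma hilbert_ideal_graded : graded_ideal H.
Proof.
have iH := hilbert_ideal_pred; split=> // k.
move=> _ [l [a [u [hu ->]]]]; rewrite linear_sum; apply: ideal_pred_sum => // i _ /=.
have [_ _ HM] := iH; have [_ [d _ hd]] := hu i.
have [dk|kd] := leqP d k; last by rewrite (pihomogM_lt _ hd kd); case: iH.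
by rewrite -(subnKC dk) (pihomogM _ _ hd); apply/HM/pos_invariant_mem.
Qed.

Lemma mpoly_actX g i : mpoly_act rG g 'X_i = \sum_(j < n) rG g^-1%g i j *: 'X_j.
Proof. by rewrite /mpoly_act comp_tnth tnth_mktuple. Qed.

Lemma mpoly_act_homogX g i : mpoly_act rG g 'X_i \is 1.-homog.
Proof.
rewrite mpoly_actX; apply: rpred_sum => j _; apply: rpredZ.
by rewrite dhomogX; apply/eqP/mdeg1.
Qed.

Lemma mpoly_actXM g h i : g \in G -> h \in G ->
  mpoly_act rG g (mpoly_act rG h 'X_i) = mpoly_act rG (g * h)%g 'X_i.
Proof.
move=> Gg Gh; rewrite [in LHS]mpoly_actX [in LHS]/mpoly_act linear_sum /=.
under eq_bigr => j _ do rewrite comp_mpolyZ -/(mpoly_act rG g 'X_j) mpoly_actX scaler_sumr.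
rewrite exchange_big mpoly_actX; apply: eq_bigr => k _ /=.
under eq_bigr => j _ do rewrite scalerA.
by rewrite -scaler_suml invMg repr_mxM ?groupV // mxE.
Qed.

Lemma mpoly_actX1 i : mpoly_act rG 1%g 'X_i = 'X_i.
Proof.
rewrite mpoly_actX invg1 repr_mx1 (bigD1 i) //= mxE eqxx scale1r big1 ?addr0 // => j ji.
by rewrite mxE eq_sym (negbTE ji) scale0r.
Qed.

Lemma coef_prod_XsubC_homog (r : seq S) j : (forall a, a \in r -> a \is 1.-homog) ->
  (\prod_(a <- r) ('X - a%:P))`_j \is (size r - j).-homog.
Proof.
elim: r j => [|a r IH] j hr.
  by rewrite big_nil coef1; case: j => [|j]; [exact: dhomog1 | exact: dhomog0].
have {}IH l : (\prod_(b <- r) ('X - b%:P))`_l \is (size r - l).-homog.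
  by apply: IH => b br; apply: hr; rewrite inE br orbT.
rewrite big_cons mulrBl coefB coefXM coefCM; apply: rpredB.
  by case: j => [|j] /=; [exact: dhomog0 | exact: IH].
have [jr|rj] := leqP j (size r).
  by rewrite /= subSn // -add1n; apply: dhomogM (IH j); apply: hr; rewrite mem_head.
by rewrite nth_default ?mulr0 ?dhomog0 // size_prod_XsubC.
Qed.

(** The monic polynomial with the orbit of 'X_i as its roots, counted with
    multiplicity. *)
Definition orbit_poly i : {poly S} :=
  \prod_(a <- [seq mpoly_act rG g 'X_i | g <- enum G]) ('X - a%:P).

Lemma orbit_poly_invariant i j : Defs.invariant rG (orbit_poly i)`_j.
Proof.
move=> h Gh; rewrite /mpoly_act -coef_map; congr (polyseq _)`_j.
rewrite /orbit_poly big_map big_enum rmorph_prod /= [RHS](reindex_inj (mulgI h)) /=.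
apply: eq_big => [g|g Gg]; first by rewrite groupMl.
by rewrite rmorphB /= map_polyX map_polyC /= -mpoly_actXM.
Qed.

(** 'X_i is a root of [orbit_poly i], whose coefficients other than the leading
    one are invariants of positive degree.  Stated for any ideal containing
    these, as it serves both for the Hilbert ideal and for the radical of the
    ideal of a system of parameters. *)
Lemma pow_card_mem (J : S -> Prop) i : ideal_pred J ->
  (forall u, pos_invariant rG u -> J u) -> J ('X_i ^+ #|G|).
Proof.
move=> iJ uJ; have szG : size [seq mpoly_act rG g 'X_i | g <- enum G] = #|G|.
  by rewrite size_map -cardE.
have : root (orbit_poly i) 'X_i.
  rewrite root_prod_XsubC; apply/mapP; exists 1%g; last by rewrite mpoly_actX1.
  by rewrite mem_enum group1.
have sz : size (orbit_poly i) = #|G|.+1 by rewrite size_prod_XsubC szG.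
have lead : (orbit_poly i)`_#|G| = 1.
  by have /monicP := monic_prod_XsubC [seq mpoly_act rG g 'X_i | g <- enum G] xpredT id;
    rewrite lead_coefE -/(orbit_poly i) sz.
rewrite /root horner_coef sz big_ord_recr /= lead mul1r addrC addr_eq0 => /eqP->.
apply: ideal_predN => //; apply: ideal_pred_sum => // j _; apply: ideal_predMr => //.
apply: uJ; split; first exact: orbit_poly_invariant.
exists (#|G| - j)%N; first by rewrite subn_gt0.
have := @coef_prod_XsubC_homog [seq mpoly_act rG g 'X_i | g <- enum G] j.
rewrite szG; apply=> a /mapP[g _ ->].
exact: mpoly_act_homogX.
Qed.

Lemma hilbert_ideal_cofinite : cofinite H.
Proof.
apply: (cofinite_pow (N := #|G|)) hilbert_ideal_pred _ => i.
exact: pow_card_mem hilbert_ideal_pred pos_invariant_mem.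
Qed.

Lemma coinv_piZ c p : coinv_pi rG (c *: p) = c *: coinv_pi rG p.
Proof.
rewrite -mul_mpolyC; exact: rmorphM (\pi_(coinvariants rG)%qT) _ _.
Qed.

End HilbertIdeal.

(** * A basis of the coinvariant ring *)

Section Coinvariants.
Variables (F : fieldType) (gT : finGroupType) (G : {group gT}) (n : nat).
Variable rG : mx_representation F G n.
Local Notation S := {mpoly F[n]}.
Local Notation H := (in_hilbert_ideal rG).
Local Notation pi := (coinv_pi rG).

Lemma coinv_piD p q : pi (p + q) = pi p + pi q.
Proof. exact: (rmorphD (\pi_(coinvariants rG)%qT)). Qed.

Lemma coinv_pi_onto x : exists p, pi p = x.
Proof. by elim/generic_quotient.quotW: x => p; exists p. Qed.

(** Bases of complements of the homogeneous components of the Hilbert ideal,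
    taken together in all degrees below [K], give a basis of the coinvariants. *)
Lemma coinv_dim K : (forall k, (K <= k)%N -> hilb H k = 0%N) ->
  coinv_has_dim rG (\sum_(k < K) hilb H k).
Proof.
move=> hK; have iH := hilbert_ideal_pred rG; have gH := hilbert_ideal_graded rG.
pose C (k : 'I_K) := ((ideal_part H k)^C)%VS.
pose T : finType := {k : 'I_K & 'I_(\dim (C k))}.
have -> : (\sum_(k < K) hilb H k = #|{: T}|)%N.
  rewrite card_tagged sumnE big_map big_enum; apply: eq_bigr => k _ /=.
  by rewrite card_ord dimv_compl.
pose b k i : hform F n (k : 'I_K) := (vbasis (C k))`_i.
pose c (r : 'rV[F]_#|{: T}|) k (i : 'I_(\dim (C k))) :=
  r 0 (enum_rank (Tagged (fun k => 'I_(\dim (C k))) i : T)) : F.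
pose v r k : hform F n (k : 'I_K) := \sum_(i < \dim (C k)) c r k i *: b k i.
pose g r := pi (\sum_(k < K) val (v r k)).
apply: (@bij_vector_axiom _ _ _ g).
- move=> a r r'; rewrite /g -coinv_piZ -coinv_piD; congr (pi _).
  rewrite scaler_sumr -big_split; apply: eq_bigr => k _ /=.
  have -> : v (a *: r + r') k = a *: v r k + v r' k; last by [].
  rewrite /v scaler_sumr -big_split; apply: eq_bigr => i _ /=.
  by rewrite /c !mxE scalerDl scalerA.
- move=> r /coinv_pi_eq0 Hr; have cr k i : c r k i = 0.
    have vH : v r k \in ideal_part H k.
      apply/(mem_ideal_part _ iH); have := gH.2 k _ Hr; rewrite linear_sum (bigD1 k) //=.
      rewrite (pihomog_dE (dhomog_is_dhomog (v r k))) big1 ?addr0 // => l lk.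
      by rewrite (pihomog_ne0 _ (dhomog_is_dhomog (v r l))).
    have vC : v r k \in C k.
      apply: memv_suml => j _; apply: memvZ; apply: vbasis_mem.
      by rewrite mem_nth // size_tuple.
    have v0 : v r k = 0.
      by apply/eqP; rewrite -memv0 -(capv_compl (ideal_part H k)) memv_cap vH.
    have /freeP := basis_free (vbasisP (C k)); apply; exact: v0.
  apply/rowP => z; rewrite mxE -[z]enum_valK; case: (enum_val z) => k i.
  exact: (cr k i).
- move=> x; have [p <-] := coinv_pi_onto x.
  have dec (k : 'I_K) : exists a : 'I_(\dim (C k)) -> F,
      H (pihomog mdeg k p - val (\sum_(i < \dim (C k)) a i *: b k i)).
    pose u : hform F n k := DHomog (pihomogP mdeg k p).
    have : u \in (ideal_part H k + C k)%VS by rewrite addv_complf memvf.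
    case/memv_addP=> w /(mem_ideal_part _ iH) Hw [w' /coord_vbasis ew eu].
    exists (fun i => coord (vbasis (C k)) i w'); rewrite -ew.
    have -> : pihomog mdeg k p = val w + val w' := congr1 val eu.
    by rewrite addrK.
  have {}dec k := cid (dec k); pose a k := projT1 (dec k).
  exists (\row_z a (tag (enum_val z)) (tagged (enum_val z))).
  set r := \row__ _.
  have vH (k : 'I_K) : H (pihomog mdeg k p - val (v r k)).
    rewrite /v; under eq_bigr => i _ do rewrite /c mxE enum_rankK /=.
    exact: projT2 (dec k).
  have pH : H (p - \sum_(k < K) pihomog mdeg k p).
    rewrite {1}(pihomog_partitionE (leq_maxr K (msize p))).
    rewrite (big_ord_widen _ (fun k => pihomog mdeg k p) (leq_maxl K (msize p))).
    rewrite [in X in _ - X]big_mkcond -sumrB; apply: ideal_pred_sum => // k _ /=.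
    case: ltnP => [_|Kk]; first by rewrite subrr; case: iH.
    rewrite subr0; have /(hilb_eq0 _ iH) := hK _ Kk; apply; exact: pihomogP.
  apply/esym/eqP; rewrite -subr_eq0 -scaleN1r -coinv_piZ -coinv_piD scaleN1r.
  apply/eqP/coinv_pi_eq0; rewrite -[p](subrK (\sum_(k < K) pihomog mdeg k p)) -addrA -sumrB.
  have [_ HD _] := iH; apply: HD => //; exact: ideal_pred_sum.
Qed.



End Coinvariants.

(** * Homogeneous systems of parameters of the invariant ring *)

Section Hsop.
Variables (F : fieldType) (gT : finGroupType) (G : {group gT}) (n : nat).
Variable rG : mx_representation F G n.
Local Notation S := {mpoly F[n]}.
Local Notation H := (in_hilbert_ideal rG).
Variables (fs : n.-tuple S) (d : 'I_n -> nat).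

Definition with_degrees : seq (nat * S) := [seq (d i, tnth fs i) | i <- enum 'I_n].

Lemma with_degrees_mem i : (d i, tnth fs i) \in with_degrees.
Proof. by apply: map_f; rewrite mem_enum. Qed.

Lemma comp_mod_parameters p : ideal_of with_degrees (p \mPo fs - (p@_0%MM)%:MP).
Proof.
have iI := ideal_of_ideal with_degrees; have [I0 ID IM] := iI.
move: p; apply: mpoly_gen_ind => [c|i|p q Ip Iq|p q Ip Iq].
- by rewrite comp_mpolyC mpolyCK subrr.
- rewrite comp_tnth mcoeffX -[(_ == _)]/(U_(i)%MM == 0%MM) mnm1_eq0 mpolyC0 subr0.
  exact: (ideal_of_mem (with_degrees_mem i)).
- by rewrite comp_mpolyD mcoeffD mpolyCD opprD addrACA; apply: ID.
- rewrite rmorphM (rmorphM (mcoeff 0%MM)) mpolyCM /=.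
  have -> : forall a b a' b' : S, a * b - a' * b' = a * (b - b') + b' * (a - a') by move=> *; ring.
  by apply: ID; apply: IM.
Qed.

Hypothesis fs_hsop : hsop rG fs d.

Lemma with_degrees_homs : graded_seq with_degrees.
Proof.
case: fs_hsop => hfs _ _; apply/allP => _ /mapP[i _ ->] /=.
by have [_ -> ->] := hfs i.
Qed.

Lemma with_degrees_hilbert p : ideal_of with_degrees p -> H p.
Proof.
case: fs_hsop => hfs _ _; apply: ideal_of_min; first exact: hilbert_ideal_pred.
move=> _ /mapP[i _ ->] /=; apply: pos_invariant_mem; have [inv di hi] := hfs i.
by split=> //; exists (d i).
Qed.

Lemma pihomog_ge k (p : S) : (msize p <= k)%N -> pihomog mdeg k p = 0.
Proof.
move=> pk; rewrite pihomogE big_seq_cond big1 // => m /andP[mp /eqP mk].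
by have := msize_mdeg_lt mp; rewrite [mdeg m]mk ltnNge pk.
Qed.

(** A power of [u] is a combination of the module generators with coefficients in
    F, up to an element of the ideal.  For a large exponent its degree exceeds
    those of the generators, so that only the element of the ideal remains. *)
Lemma pos_invariant_radical u : pos_invariant rG u -> radical (ideal_of with_degrees) u.
Proof.
move=> [inv [k k0 hu]]; have iI := ideal_of_ideal with_degrees;
have gI := ideal_of_graded with_degrees_homs.
have [_ _ [l [s [_ fin]]]] := fs_hsop.
pose D := (\max_(i < l) msize (s i))%N; exists D.
have [c uD] : exists c : 'I_l -> S, u ^+ D = \sum_(i < l) (c i \mPo fs) * s i.
  apply: fin => g Gg; have := inv g Gg; rewrite /mpoly_act rmorphXn /= => ->.
  by [].
have : ideal_of with_degrees (u ^+ D - \sum_(i < l) (c i)@_0%MM *: s i).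
  rewrite uD -sumrB; apply: ideal_pred_sum => // i _.
  by rewrite -mul_mpolyC -mulrBl; apply: ideal_predMr => //; apply: comp_mod_parameters.
move/(gI.2 (k * D)%N); rewrite linearB (linear_sum (pihomog mdeg (k * D)%N)) /=
  (pihomog_dE (dhomogMn D hu)).
rewrite big1 ?subr0 => [|i _]; first exact.
rewrite linearZ /= pihomog_ge ?scaler0 //.
apply: leq_trans (leq_pmull D k0); exact: (leq_bigmax i).
Qed.

(** All 'X_i are nilpotent modulo the ideal, since the positive invariants
    are. *)
Lemma with_degrees_cofinite : cofinite (ideal_of with_degrees).
Proof.
have iI := ideal_of_ideal with_degrees.
have nil i := pow_card_mem i (radical_ideal iI) pos_invariant_radical.
pose M i := projT1 (cid (nil i)); pose N := (\sum_i #|G| * M i)%N.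
apply: (cofinite_pow (N := N) iI) => i; apply: (radical_pow iI (M := #|G| * M i)).
  by rewrite exprM; exact: projT2 (cid (nil i)).
by rewrite /N (bigD1 i) //= leq_addr.
Qed.

(** An invariant of positive degree is a polynomial in the parameters.  Its
    constant term vanishes, since otherwise 1 would be in the Hilbert ideal. *)
Lemma generates_hilbert p : generates_invariants rG fs -> H p -> ideal_of with_degrees p.
Proof.
move=> gen; have iI := ideal_of_ideal with_degrees; have iH := hilbert_ideal_pred rG.
apply: hilbert_ideal_min => // u hu; have [q uq] := gen u hu.1.
have Iu := comp_mod_parameters q; rewrite -uq in Iu.
have : H (q@_0%MM)%:MP.
  rewrite -(subKr u (q@_0%MM)%:MP); apply: ideal_predB => //; first exact: pos_invariant_mem.
  exact: with_degrees_hilbert.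
have [q0 _|q0 Hq] := eqVneq (q@_0%MM) 0; first by rewrite q0 mpolyC0 subr0 in Iu.
case: (@hilbert_ideal1 _ _ _ _ rG); rewrite -mpolyC1 -(mulVf q0) mpolyCM.
by case: iH => _ _; apply.
Qed.

Lemma with_degrees_sum : (\sum_(u <- with_degrees) (u.1 - 1) = \sum_(i < n) (d i - 1))%N.
Proof. by rewrite big_map big_enum. Qed.
Lemma with_degrees_prod : (\prod_(u <- with_degrees) u.1 = \prod_(i < n) d i)%N.
Proof. by rewrite big_map big_enum. Qed.
Lemma with_degrees_size : size with_degrees = n.
Proof. by rewrite size_map size_enum_ord. Qed.

End Hsop.

Local Open Scope nat_scope.

Theorem theorem7 (F : fieldType) (gT : finGroupType) (G : {group gT}) (n : nat)
    (rG : mx_representation F G n) :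
  exists t m : nat,
    [/\ is_topdeg rG t,
        coinv_has_dim rG m,
        (forall (fs : n.-tuple {mpoly F[n]}) (d : 'I_n -> nat), hsop rG fs d ->
           [/\ t <= \sum_(i < n) (d i - 1),
               m <= \prod_(i < n) d i
             & generates_invariants rG fs ->
                 t = \sum_(i < n) (d i - 1) /\ m = \prod_(i < n) d i]),
        t <= n * (#|G| - 1)
      & m <= #|G| ^ n].
Proof.
pose H := in_hilbert_ideal rG.
have iH : ideal_pred H := hilbert_ideal_pred rG.
have gH : graded_ideal H := hilbert_ideal_graded rG.
have [K cof] := hilbert_ideal_cofinite rG.
have hK k : K <= k -> hilb H k = 0.
  by move=> Kk; apply/(hilb_eq0 _ iH) => p; apply: cof.
have h0 : exists k, hilb H k != 0.
  exists 0; apply/eqP => /(hilb_eq0 _ iH) H0; apply: (@hilbert_ideal1 _ _ _ _ rG).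
  by apply: H0; apply: dhomog1.
have hle k : hilb H k != 0 -> k <= K.
  by move=> hk; rewrite leqNgt; apply: contra hk => /ltnW/hK->.
case: (ex_maxnP h0 hle) => t ht tmax.
have bound := parameters_bound iH ht tmax hK.
pose pow := [tuple ('X_i ^+ #|G|)%R | i < n] : n.-tuple {mpoly F[n]}.
pose s := with_degrees pow (fun _ => #|G|).
have sH p : ideal_of s p -> H p.
  apply: ideal_of_min => // _ /mapP[i _ ->] /=; rewrite tnth_mktuple.
  exact: pow_card_mem iH (@pos_invariant_mem _ _ _ _ rG).
have hs : graded_seq s.
  apply/allP => _ /mapP[i _ ->] /=; rewrite cardG_gt0 tnth_mktuple /=.
  have := @dhomogMn n F mdeg 1 'X_i #|G|; rewrite mul1n; apply.
  by rewrite dhomogX; apply/eqP/mdeg1.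
have cofs : cofinite (ideal_of s).
  apply: (cofinite_pow (N := #|G|)); first exact: ideal_of_ideal.
  move=> i; have := ideal_of_mem (with_degrees_mem pow (fun _ => #|G|) i).
  by rewrite /= tnth_mktuple.
have [tG mG _] := bound s (with_degrees_size _ _) hs cofs sH.
exists t, (\sum_(k < K) hilb H k); split.
- split.
    apply: contrapT => no; case/negP: ht; apply/eqP/(hilb_eq0 _ iH) => p hp.
    apply/coinv_pi_eq0; apply: contrapT => px; apply: no; exists (coinv_pi rG p) => //.
    by exists p.
  move=> d x [p hp <-] px; apply: tmax; apply/eqP => /(hilb_eq0 _ iH) hd.
  by apply: px; apply/coinv_pi_eq0/hd.
- exact: coinv_dim hK.
- move=> fs d fs_hsop.
  have := bound _ (with_degrees_size _ _) (with_degrees_homs fs_hsop) (with_degrees_cofinite fs_hsop)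
    (@with_degrees_hilbert _ _ _ _ _ _ _ fs_hsop).
  rewrite with_degrees_sum with_degrees_prod => -[tle mle eq]; split=> // gen.
  by apply: eq => p; apply: generates_hilbert.
- by move: tG; rewrite with_degrees_sum sum_nat_const card_ord.
- by move: mG; rewrite with_degrees_prod prod_nat_const card_ord.
Qed.
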